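(* Let $n\geq1$, let $\|\cdot\|$ be any norm on $\mathbb{C}^n$, and let $B$ and $S$ be the corresponding open unit ball and unit sphere. Let $M\subset S$ be a non-empty countable subset, and let $\mathcal{F}\subset H^\infty(B)$ be the set of functions $f$ for which there exists a disc $\mathbf{D}\subset\mathbb{C}$ (of positive radius, possibly depending on $f$) such that $$\mathbf{D}\subset\bigcap_{z\in M} rCl(f,z).$$ Then: (I) The set $\mathcal{F}\cup\{0\}$ contains an isomorphic copy of $\ell_1$ (that is, a closed linear subspace of $H^\infty(B)$ that is isomorphic, as a Banach space, to $\ell_1$). In particular, $\mathcal{F}$ is spaceable. (II) The set $\mathcal{F}$ is pointwise strongly $\mathfrak{c}$-algebrable and, in particular, strongly $\mathfrak{c}$-algebrable.
   Context: $H^\infty(B)$ is the Banach algebra of bounded holomorphic functions $f:B\to\mathbb{C}$ with the supremum norm. For $f\in H^\infty(B)$ and $x\in S$, the radial cluster set $rCl(f,x)$ is the set of all $\mu\in\mathbb{C}$ for which there exists a sequence $(t_k)_{k=1}^\infty\subset(0,1)$ with $\lim_{k\to\infty}t_k=1$ and $\lim_{k\to\infty}f(t_kx)=\mu$. $\mathfrak{c}$ is the cardinality of the continuum. A subset $C$ of a Banach space is spaceable if $C\cup\{0\}$ contains a closed infinite-dimensional linear subspace. For a commutative (complex) algebra $\mathcal{A}$ and an infinite cardinal $\kappa$, a subset $C\subset\mathcal{A}$ is strongly $\kappa$-algebrable if $C\cup\{0\}$ contains a subalgebra of $\mathcal{A}$ generated by an algebraically independent set of cardinality $\kappa$. A non-empty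 subset $C\subset\mathcal{A}$ is pointwise strongly $\mathfrak{c}$-algebrable if for every $f\in C$ there is a subalgebra $\mathcal{B}$ of $\mathcal{A}$ which is generated by an algebraically independent set $G$ of cardinality $\mathfrak{c}$ and satisfies $f\in\mathcal{B}\subset C\cup\{0\}$. Subalgebras are not required to contain the unit: the subalgebra generated by a set $G$ consists of all values $Q(g_1,\dots,g_N)$ of complex polynomials $Q$ without constant term at elements $g_1,\dots,g_N\in G$. A set $G$ is algebraically independent if $Q(g_1,\dots,g_N)\neq0$ for all distinct $g_1,\dots,g_N\in G$ and all non-zero complex polynomials $Q$ in $N$ variables. *)

(* Defs.v *)
From HB Require Import structures.
From mathcomp Require Import all_boot all_order all_algebra.
From mathcomp Require Import complex.
From mathcomp Require Import all_classical all_reals all_analysis.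
From mathcomp Require mpoly.
(* The notations of mpoly clash with those of analysis. *)
Import (canonicals) mpoly.

Set Implicit Arguments.
Unset Strict Implicit.
Unset Printing Implicit Defensive.
Set Warnings "-redundant-canonical-projection".

Import Order.TTheory GRing.Theory Num.Theory.
Import numFieldNormedType.Exports.

Local Open Scope classical_set_scope.
Local Open Scope ring_scope.
Local Open Scope complex_scope.

HB.instance Definition _ (R : rcfType) := NormedModule.copy R[i] R[i]^o.

(* Real-valued modulus: `|x| = (modc x)%:C holds by conversion. *)
Notation modc := ComplexField.Normc.normc.

Section Modulus.
Variable R : rcfType.
Implicit Types x y : R[i].

Lemma modcE x : `|x| = (modc x)%:C. Proof. by []. Qed.

Lemma modc_ge0 x : 0 <= modc x. Proof. by case: x => a b; exact: sqrtr_ge0. Qed.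

Lemma modcD x y : modc (x + y) <= modc x + modc y.
Proof. by rewrite -lecR rmorphD -!modcE ler_normD. Qed.

Lemma modcM x y : modc (x * y) = modc x * modc y.
Proof. exact: ComplexField.Normc.normcM. Qed.

Lemma modc0 : modc (0 : R[i]) = 0. Proof. exact: ComplexField.Normc.normc0. Qed.
Lemma modc1 : modc (1 : R[i]) = 1. Proof. exact: ComplexField.Normc.normc1. Qed.

Lemma modc0_eq0 x : modc x = 0 -> x = 0.
Proof. exact: ComplexField.Normc.eq0_normc. Qed.

Lemma modcN x : modc (- x) = modc x.
Proof. by apply: (@complexI R); rewrite -!modcE normrN. Qed.

End Modulus.

Lemma near_eq_differentiable (K : numFieldType) (V W : normedModType K)
    (f g : V -> W) (x : V) :
  {near x, f =1 g} -> differentiable f x -> differentiable g x.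
Proof.
move=> fg dfx; have fgx : f x = g x := nbhs_singleton fg.
have gE : g \o shift x = cst (g x) + 'd f x +o_ 0 id.
  apply/eqaddoP => e e0; have /eqaddoP/(_ e e0) := diff_locally dfx.
  have : \forall h \near 0, f (h + x) = g (h + x).
    by have := fg; rewrite (near_shift 0 x); apply: filterS => h /=; rewrite subr0.
  by apply: filterS2 => h /= fgh; rewrite !fctE /= fgh fgx.
apply/diff_locallyP.
by rewrite (diff_unique (diff_continuous dfx) gE); split => //; exact: diff_continuous.
Qed.

Section NormsOnCn.
Variables (R : realType) (n : nat).

Record cnorm := CNorm {
  cnorm_fun :> 'rV[R[i]]_n -> R;
  cnormD : forall x y, cnorm_fun (x + y) <= cnorm_fun x + cnorm_fun y;
  cnormZ : forall (a : R[i]) x, cnorm_fun (a *: x) = modc a * cnorm_fun x;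
  cnorm0_eq0 : forall x, cnorm_fun x = 0 -> x = 0
}.

Definition unit_ball (N : cnorm) : set 'rV[R[i]]_n := [set z | N z < 1].
Definition unit_sphere (N : cnorm) : set 'rV[R[i]]_n := [set z | N z = 1].

Variable N : cnorm.

Lemma cnorm0 : N 0 = 0.
Proof. by have := cnormZ N 0 0; rewrite scale0r modc0 mul0r. Qed.

Lemma cnormN x : N (- x) = N x.
Proof. by rewrite -scaleN1r cnormZ modcN modc1 mul1r. Qed.

Lemma cnorm_ge0 x : 0 <= N x.
Proof.
have := cnormD N x (- x); rewrite subrr cnorm0 cnormN.
by rewrite -mulr2n pmulrn_lge0.
Qed.

Lemma unit_ball0 : unit_ball N 0.
Proof. by rewrite /unit_ball /= cnorm0 ltr01. Qed.

Lemma cnorm_le_mx_norm : exists2 C, 0 < C & forall x, (N x)%:C <= C%:C * `|x|.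
Proof.
exists (1 + \sum_i N (delta_mx 0 i)).
  by rewrite ltr_pwDl ?ltr01// sumr_ge0// => i _; exact: cnorm_ge0.
move=> x.
have xi i : `|x ord0 i| <= `|x|.
  rewrite [leRHS]mx_normE -[leLHS]nngE num_le.
  exact: (le_bigmax _ (fun ij => `|x ij.1 ij.2|%:nng) (ord0, i)).
have : N x <= \sum_i modc (x ord0 i) * N (delta_mx 0 i).
  rewrite {1}(row_sum_delta x); elim/big_rec2 : _ => [|i a b _ ab].
    by rewrite cnorm0.
  by rewrite (le_trans (cnormD _ _ _))// cnormZ lerD2l.
rewrite -lecR => /le_trans; apply.
rewrite rmorphD mulrDl.
apply: (@le_trans _ _ ((\sum_i N (delta_mx 0 i))%:C * `|x|)); last first.
  by rewrite lerDr mulr_ge0// ler0c.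
rewrite !rmorph_sum mulr_suml ler_sum// => i _.
rewrite [leLHS](_ : _ = (N (delta_mx 0 i))%:C * `|x ord0 i|).
  by rewrite ler_wpM2l// ler0c cnorm_ge0.
by rewrite mulrC rmorphM.
Qed.

Lemma open_unit_ball : open (unit_ball N).
Proof.
have [C C0 NC] := cnorm_le_mx_norm.
rewrite openE => x Bx; rewrite /interior -nbhs_ballE.
exists ((1 - N x) / C)%:C => /=.
  by rewrite ltcR divr_gt0// subr_gt0.
move=> y; rewrite -ball_normE /= => xy.
rewrite /unit_ball /= -(subrK x y) (le_lt_trans (cnormD _ _ _))//.
rewrite -ltrBrDr -cnormN opprB -ltcR (le_lt_trans (NC _))//.
by rewrite -ltr_pdivlMl ?ltcR// -fmorphV -rmorphM mulrC.
Qed.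

(* 'valL_0 f extends f by 0 outside the (open) ball. *)
Definition holomorphic (f : unit_ball N -> R[i]) :=
  forall z, unit_ball N z -> differentiable ('valL_0 f) z.

Definition bounded_on_ball (f : unit_ball N -> R[i]) :=
  exists M : R, forall z, modc (f z) <= M.

Definition hinf_pred : {pred (unit_ball N -> R[i])} :=
  fun f => `[< holomorphic f /\ bounded_on_ball f >].


Lemma valL0_in (f : unit_ball N -> R[i]) z (Bz : z \in unit_ball N) :
  'valL_0 f z = f (SigSub Bz).
Proof. by rewrite /= oinv_set_val insubT. Qed.

Lemma valL0_notin (f : unit_ball N -> R[i]) z :
  z \notin unit_ball N -> 'valL_0 f z = 0.
Proof. by move=> Bz; rewrite /= oinv_set_val insubN. Qed.

Lemma valL0B (f g : unit_ball N -> R[i]) :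
  'valL_0 (f - g) = 'valL_0 f - 'valL_0 g :> ('rV[R[i]]_n -> R[i]).
Proof.
apply/funext => z; rewrite !fctE; have [Bz|Bz] := boolP (z \in unit_ball N).
  by rewrite !(valL0_in _ Bz).
by rewrite !valL0_notin// subr0.
Qed.

Lemma valL0M (f g : unit_ball N -> R[i]) :
  'valL_0 (f * g) = 'valL_0 f * 'valL_0 g :> ('rV[R[i]]_n -> R[i]).
Proof.
apply/funext => z; rewrite !fctE; have [Bz|Bz] := boolP (z \in unit_ball N).
  by rewrite !(valL0_in _ Bz).
by rewrite !valL0_notin// mulr0.
Qed.

Lemma valL0Z (a : R[i]) (f : unit_ball N -> R[i]) :
  'valL_0 (a *: f) = a *: ('valL_0 f : 'rV[R[i]]_n -> R[i]).
Proof.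
apply/funext => z; rewrite -[RHS]/(a *: 'valL_0 f z).
have [Bz|Bz] := boolP (z \in unit_ball N).
  by rewrite !(valL0_in _ Bz).
by rewrite !valL0_notin// scaler0.
Qed.

Lemma holomorphic_cst (c : R[i]) : holomorphic (cst c).
Proof.
move=> z Bz; apply: (@near_eq_differentiable _ _ _ (cst c)); last first.
  exact: differentiable_cst.
apply: filterS (open_nbhs_nbhs (conj open_unit_ball Bz)) => y By.
by rewrite (valL0_in _ (mem_set By)).
Qed.

Lemma hinf_pred_subring : subring_closed hinf_pred.
Proof.
split.
- apply/asboolP; split; first exact: holomorphic_cst.
  by exists 1 => z; rewrite modc1.
- move=> f g /asboolP[hf [A fA]] /asboolP[hg [B gB]]; apply/asboolP; split.
    move=> z Bz; rewrite valL0B.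
    by apply: differentiableB; [exact: hf|exact: hg].
  exists (A + B) => z; rewrite !fctE (le_trans (modcD _ _))// modcN.
  by rewrite lerD.
- move=> f g /asboolP[hf [A fA]] /asboolP[hg [B gB]]; apply/asboolP; split.
    move=> z Bz; rewrite valL0M.
    by apply: differentiableM; [exact: hf|exact: hg].
  exists (A * B) => z; rewrite !fctE modcM.
  by rewrite ler_pM// modc_ge0.
Qed.

Lemma hinf_pred_scale : scaler_closed hinf_pred.
Proof.
move=> a f /asboolP[hf [A fA]]; apply/asboolP; split.
  by move=> z Bz; rewrite valL0Z; apply: differentiableZ; exact: hf.
by exists (modc a * A) => z; rewrite fctE modcM ler_wpM2l// modc_ge0.
Qed.

HB.instance Definition _ :=
  GRing.isSubringClosed.Build (unit_ball N -> R[i]) hinf_pred hinf_pred_subring.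
HB.instance Definition _ :=
  GRing.isScaleClosed.Build R[i] (unit_ball N -> R[i]) hinf_pred hinf_pred_scale.

Record Hinf := MkHinf {
  hinf_val :> unit_ball N -> R[i];
  _ : hinf_val \in hinf_pred
}.

HB.instance Definition _ := [isSub of Hinf for hinf_val].
HB.instance Definition _ := [Choice of Hinf by <:].
HB.instance Definition _ := GRing.SubChoice_isSubPzRing.Build
  (unit_ball N -> R[i]) hinf_pred Hinf hinf_pred_subring.
HB.instance Definition _ := GRing.SubPzRing_isSubComPzRing.Build
  (unit_ball N -> R[i]) hinf_pred Hinf.
HB.instance Definition _ := [SubZmodule_isSubLmodule of Hinf by <:].

Lemma hinfP (f : Hinf) : holomorphic f /\ bounded_on_ball f.
Proof. by apply/asboolP; exact: (valP f). Qed.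

Lemma hinf1_neq0 : (1 : Hinf) != 0.
Proof.
apply/eqP => /(congr1 (fun f : Hinf => f (SigSub (mem_set unit_ball0)))).
by move/eqP; rewrite oner_eq0.
Qed.

HB.instance Definition _ := GRing.PzSemiRing_isNonZero.Build Hinf hinf1_neq0.

Lemma hinf_scaleAl (a : R[i]) (f g : Hinf) : a *: (f * g) = a *: f * g.
Proof. by apply/val_inj/funext => z; rewrite /= -[LHS]/(a * (f z * g z)) mulrA. Qed.

HB.instance Definition _ :=
  GRing.Lmodule_isLalgebra.Build R[i] Hinf hinf_scaleAl.
HB.instance Definition _ := GRing.Lalgebra_isComAlgebra.Build R[i] Hinf.

Definition hinf_norm (f : Hinf) : R := sup (range (fun z => modc (f z))).

Lemma hinf_norm_ub (f : Hinf) z : modc (f z) <= hinf_norm f.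
Proof.
apply: ub_le_sup; last by exists z.
by have [_ [M fM]] := hinfP f; exists M => _ [y _ <-].
Qed.

Lemma hinf_norm_le (f : Hinf) M : (forall z, modc (f z) <= M) -> hinf_norm f <= M.
Proof.
move=> fM; apply: ge_sup; last by move=> _ [z _ <-].
by exists (modc (f (SigSub (mem_set unit_ball0)))), (SigSub (mem_set unit_ball0)).
Qed.

Lemma hinf_norm_ge0 (f : Hinf) : 0 <= hinf_norm f.
Proof.
exact: le_trans (modc_ge0 _) (hinf_norm_ub f (SigSub (mem_set unit_ball0))).
Qed.

Lemma hinf_normD (f g : Hinf) :
  (hinf_norm (f + g))%:C <= (hinf_norm f)%:C + (hinf_norm g)%:C.
Proof.
rewrite -rmorphD lecR; apply: hinf_norm_le => z.
by rewrite (le_trans (modcD _ _))// lerD// hinf_norm_ub.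
Qed.

Lemma hinf_normZ (a : R[i]) (f : Hinf) :
  (hinf_norm (a *: f))%:C = `|a| * (hinf_norm f)%:C.
Proof.
have le b (g : Hinf) : hinf_norm (b *: g) <= modc b * hinf_norm g.
  apply: hinf_norm_le => z; rewrite -[X in modc X]/(b * g z) modcM.
  by rewrite ler_wpM2l ?modc_ge0 ?hinf_norm_ub.
rewrite modcE -rmorphM; congr (_%:C); apply/eqP; rewrite eq_le le /=.
have [->|a0] := eqVneq a 0; first by rewrite modc0 mul0r hinf_norm_ge0.
have ma0 : 0 < modc a.
  rewrite lt_neqAle modc_ge0 andbT eq_sym.
  by apply: contra a0 => /eqP /modc0_eq0 ->.
rewrite -ler_pdivlMl// -{1}(scalerK a0 f) (le_trans (le _ _))//.
by rewrite ComplexField.Normc.normcV.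
Qed.

Lemma hinf_norm0_eq0 (f : Hinf) : (hinf_norm f)%:C = 0 -> f = 0.
Proof.
move=> /(@complexI R) f0; apply/val_inj/funext => z; apply: modc0_eq0.
by apply/eqP; rewrite eq_le modc_ge0 andbT -f0 hinf_norm_ub.
Qed.

HB.instance Definition _ := Lmodule_isNormed.Build R[i] Hinf
  hinf_normD hinf_normZ hinf_norm0_eq0.

End NormsOnCn.

Section Ell1.
Variable R : realType.

Definition summable_pred : {pred (nat -> R[i])} :=
  fun a => `[< cvgn (series (fun k => modc (a k))) >].

Lemma summable_pred_submod : submod_closed summable_pred.
Proof.
split.
  apply/asboolP; rewrite (_ : series _ = cst 0); first exact: is_cvg_cst.
  by apply/funext => k; rewrite /series /= big1// => j _; exact: modc0.
move=> c a b /asboolP ha /asboolP hb; apply/asboolP.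
apply: (@series_le_cvg _ _ (modc c *: (fun k => modc (a k)) + (fun k => modc (b k)))).
- by move=> k; exact: modc_ge0.
- move=> k; rewrite -[leRHS]/(modc c * modc (a k) + modc (b k)).
  by rewrite addr_ge0 ?mulr_ge0 ?modc_ge0.
- move=> k; rewrite -[leRHS]/(modc c * modc (a k) + modc (b k)).
  by rewrite -modcM; exact: modcD.
- by apply: is_cvg_seriesD => //; exact: is_cvg_seriesZ.
Qed.

HB.instance Definition _ := GRing.isSubmodClosed.Build R[i] (nat -> R[i])
  summable_pred (GRing.submod_closed_semi summable_pred_submod).

Record ell1 := MkEll1 {
  ell1_val :> nat -> R[i];
  _ : ell1_val \in summable_pred
}.

HB.instance Definition _ := [isSub of ell1 for ell1_val].
HB.instance Definition _ := [Choice of ell1 by <:].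
HB.instance Definition _ := GRing.SubChoice_isSubLmodule.Build R[i]
  (nat -> R[i]) summable_pred ell1 summable_pred_submod.

Lemma ell1P (a : ell1) : cvgn (series (fun k => modc (a k))).
Proof. by apply/asboolP; exact: (valP a). Qed.

Arguments ell1P : clear implicits.

Definition ell1_norm (a : ell1) : R := limn (series (fun k => modc (a k))).

Lemma ell1_normD (a b : ell1) :
  (ell1_norm (a + b))%:C <= (ell1_norm a)%:C + (ell1_norm b)%:C.
Proof.
rewrite -rmorphD lecR /ell1_norm -(lim_seriesD (ell1P a) (ell1P b)).
apply: lim_series_le => [||k]; last exact: modcD.
- exact: ell1P.
- exact: is_cvg_seriesD (ell1P a) (ell1P b).
Qed.

Lemma ell1_normZ (c : R[i]) (a : ell1) :
  (ell1_norm (c *: a))%:C = `|c| * (ell1_norm a)%:C.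
Proof.
rewrite modcE -rmorphM; congr (_%:C).
rewrite /ell1_norm -[RHS](lim_seriesZ _ (ell1P a)); congr (limn (series _)).
by apply/funext => k; exact: modcM.
Qed.

Lemma ell1_norm0_eq0 (a : ell1) : (ell1_norm a)%:C = 0 -> a = 0.
Proof.
move=> /(@complexI R) a0; apply/val_inj/funext => k; apply: modc0_eq0.
apply/eqP; rewrite eq_le modc_ge0 andbT -a0.
have nd : nondecreasing_seq (series (fun k => modc (a k))).
  by apply: nondecreasing_series => j _ _; exact: modc_ge0.
apply: le_trans (nondecreasing_cvgn_le nd (ell1P a) k.+1).
rewrite /series /= big_nat_recr//= lerDr sumr_ge0// => j _.
exact: modc_ge0.
Qed.

HB.instance Definition _ := Lmodule_isNormed.Build R[i] ell1
  ell1_normD ell1_normZ ell1_norm0_eq0.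

End Ell1.

Section Spaceability.
Variable K : numFieldType.

Definition linear_subspace (V : lmodType K) (L : set V) :=
  L 0 /\ forall (a : K) u v, L u -> L v -> L (a *: u + v).

Definition finite_dimensional (V : lmodType K) (L : set V) :=
  exists (m : nat) (e : 'I_m -> V), (forall i, L (e i)) /\
    forall v, L v -> exists c : 'I_m -> K, v = \sum_(i < m) c i *: e i.

Definition spaceable (V : normedModType K) (C : set V) :=
  exists L : set V, [/\ linear_subspace L, closed L,
    ~ finite_dimensional L & L `<=` C `|` [set 0]].

(* Isomorphism of normed spaces: linear homeomorphism from X onto L. *)
Definition isomorphic_to_subspace (X Y : normedModType K) (L : set Y) :=
  exists (T : {linear X -> Y}) (S : Y -> X),
    [/\ continuous T, range T = L, cancel T S & {within L, continuous S}].

Definition contains_copy_of (X Y : normedModType K) (C : set Y) :=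
  exists L : set Y, [/\ linear_subspace L, closed L,
    isomorphic_to_subspace X L & L `<=` C].

End Spaceability.

Section Algebrability.
Variables (K : numFieldType) (A : comAlgType K).

Definition poly_value (m : nat) (Q : mpoly.mpoly m K) (g : 'I_m -> A) : A :=
  mpoly.mmap (GRing.in_alg A) g Q.

Definition constant_term (m : nat) (Q : mpoly.mpoly m K) : K :=
  mpoly.mcoeff (@mpoly.mnm0 m) Q.

Definition algebraically_independent (G : set A) :=
  forall (m : nat) (g : 'I_m -> A) (Q : mpoly.mpoly m K),
    (forall i, G (g i)) -> injective g -> Q != 0 -> poly_value Q g != 0.

(* The subalgebra generated by G is not required to contain the unit. *)
Definition generated_subalgebra (G : set A) : set A :=
  [set x | exists (m : nat) (g : 'I_m -> A) (Q : mpoly.mpoly m K),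
    [/\ forall i, G (g i), constant_term Q = 0 & x = poly_value Q g]].

(* The cardinal kappa is given as the cardinality of the set k. *)
Definition strongly_algebrable (T : Type) (k : set T) (C : set A) :=
  exists G : set A, [/\ algebraically_independent G, (G #= k)%card &
    generated_subalgebra G `<=` C `|` [set 0]].

Definition pointwise_strongly_algebrable (T : Type) (k : set T) (C : set A) :=
  C !=set0 /\ forall f, C f ->
    exists G : set A, [/\ algebraically_independent G, (G #= k)%card,
      generated_subalgebra G f & generated_subalgebra G `<=` C `|` [set 0]].

End Algebrability.

Section RadialClusterSets.
Variables (R : realType) (n : nat) (N : cnorm R n).

(* t k *: x lies in the ball for x on the sphere, so 'valL_0 f (t k *: x) is the
   genuine value of f there. *)
Definition rCl (f : Hinf N) (x : 'rV[R[i]]_n) : set R[i] :=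
  [set mu | exists t : nat -> R, [/\ forall k, 0 < t k < 1, t @ \oo --> (1 : R) &
    (fun k => 'valL_0 f ((t k)%:C *: x)) @ \oo --> mu]].

Definition disc (c : R[i]) (r : R) : set R[i] := [set w | `|w - c| < r%:C].

Definition disc_in_radial_cluster_sets (M : set 'rV[R[i]]_n) : set (Hinf N) :=
  [set f | exists (c : R[i]) (r : R),
    0 < r /\ disc c r `<=` \bigcap_(z in M) rCl f z].

End RadialClusterSets.

(* Main.v *)
Require Import Defs.
From HB Require Import structures.
From mathcomp Require Import all_boot all_order all_algebra.
From mathcomp Require Import complex.
From mathcomp Require Import all_classical all_reals all_analysis.
From mathcomp Require mpoly.
From mathcomp Require Import ring lra.
Import (canonicals, coercions) mpoly.

Set Implicit Arguments.
Unset Strict Implicit.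
Unset Printing Implicit Defensive.

Import Order.TTheory GRing.Theory Num.Theory.
Import numFieldNormedType.Exports.
Local Open Scope classical_set_scope.
Local Open Scope ring_scope.
Local Open Scope complex_scope.

(** The proof rests on asymptotic interpolation on the ball. Let [z j] be any
    sequence of points of the unit sphere (repetitions allowed). If the radii
    [t j] tend to 1 fast enough, there is a bounded linear operator [E] from
    bounded sequences to bounded holomorphic functions such that [E w] differs
    from [w j] at [t j *: z j] by an amount tending to 0 as [j] grows
    ([asymptotic_interpolation]); moreover [t j] may be taken in any prescribed
    set accumulating at 1. Since a countable set of rays can be visited
    infinitely often by one sequence, [E] reduces the theorem to the choice of
    suitable sequences [w].

    The operator is the limit of the iteration that replaces [F] by
    [F + P * (w j - F)], where [P] is the composition of a norming functional
    of [z j] with a peak polynomial. A norming functional maps the ball to the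
    unit disc and [z j] to 1 ([norming_functional], the finite-dimensional
    Hahn-Banach theorem). The peak polynomial is the partial sum of order [m]
    of the series of [- log (1 - s)], divided by the harmonic number [H m]. It
    takes the value 1 at 1, it is uniformly small on smaller discs when [m] is
    large, and on the closed disc it stays within [3 / H m] of the real segment
    from 0 to 1 ([logsum_near_segment]), whence |P| + |1 - P| <= 1 + 6 / H m.
    The last bound keeps the iterates uniformly bounded. At step [j] the value
    at [t j *: z j] becomes almost [w j], whatever it was before, and the later
    steps hardly change it because their peak functions are small there.
    Differentiability survives the passage to the limit because the
    second-order Taylor expansions of the increments are summable
    ([jet_glim_differentiable]).

    For the copy of l_1, a summable sequence [a] is sent to [E w], where
    [w j] is the sum of the [a i * q i] for a finite sequence [q] of rational
    points of the closed unit disc depending on [j], every [q] being used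
    infinitely often near every point of [M]. These sums are dense in the disc
    of radius |a|, so this disc lies in all radial cluster sets of the image.
    The operator is thus bounded below, and its range is a closed subspace
    isomorphic to l_1.

    For the algebras, let the radial cluster sets of [f] share a disc. A family
    indexed by the real line and containing [f] is constructed so that, near 1
    on each ray, the values of any finitely many members are jointly dense in
    a polydisc: the other members are [E w] for values [w] given by rational
    step functions of the index, and the radii are taken where [f] is close to
    prescribed values ([jointly_dense_family]). A polynomial in finitely many
    members either does not depend on its variables or, polynomial maps being
    open along lines ([mpoly_open_along]), has a common disc in its radial
    cluster sets ([jointly_dense_poly]). This gives both the algebraic
    independence of the family and the inclusion of the algebra that it
    generates. *)

(** * Geometric convergence in the complex plane *)

Section GeometricLimits.
Variable R : realType.
(* The modulus, with values in [R] itself rather than in the real closed field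
   underlying [R]. *)
Local Notation md z := (modc z : R).
Implicit Types (u v : nat -> R[i]) (l a z w : R[i]) (c d x e : R).

Local Notation half k := ((2^-1 : R) ^+ k).

Lemma half_exp_ge0 k : 0 <= half k. Proof. by rewrite exprn_ge0// invr_ge0. Qed.

Lemma half_exp_gt0 k : 0 < half k. Proof. by rewrite exprn_gt0// invr_gt0. Qed.

Lemma half_exp_le1 k : half k <= 1.
Proof. by rewrite exprn_ile1 ?invr_ge0// invf_le1// ler1n. Qed.

Lemma half_exp_nincr j k : (j <= k)%N -> half k <= half j.
Proof.
move=> /subnK <-; rewrite exprD ler_piMl ?half_exp_ge0//; exact: half_exp_le1.
Qed.

Lemma half_exp_small c e : 0 < e -> exists k, c * half k < e.
Proof.
move=> e0; have := @cvg_geometric R c 2^-1.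
rewrite gtr0_norm ?invr_gt0// invf_lt1// ltr1n => /(_ isT).
move/cvgrPdist_lt => /(_ _ e0) [k _ /(_ k (leqnn k))] /=.
rewrite sub0r normrN => ck; exists k; exact: le_lt_trans (ler_norm _) ck.
Qed.

Lemma le_of_half_exp c x y : (forall k, x <= y + c * half k) -> x <= y.
Proof.
move=> H; rewrite leNgt; apply/negP => yx.
have xy0 : 0 < x - y by rewrite subr_gt0.
have [k] := half_exp_small c xy0.
by rewrite ltNge lerBlDl H.
Qed.

Lemma real_geom_cauchy (u : nat -> R) c :
  (forall k, `|u k.+1 - u k| <= c * half k) ->
  exists l : R, forall k, `|u k - l| <= 2 * c * half k.
Proof.
move=> uc.
have c0 : 0 <= c by have := le_trans (normr_ge0 _) (uc 0); rewrite expr0 mulr1.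
(* The sequences [lo] and [hi] are monotone and enclose the limit. *)
pose lo k := u k - 2 * c * half k; pose hi k := u k + 2 * c * half k.
have hS k : half k.+1 = half k / 2 by rewrite exprSr.
have los k : lo k <= lo k.+1.
  have := uc k; rewrite ler_norml /lo hS => /andP[+ _]; lra.
have his k : hi k.+1 <= hi k.
  have := uc k; rewrite ler_norml /hi hS => /andP[_ +]; lra.
have lohi k : lo k <= hi k.
  by have := mulr_ge0 c0 (half_exp_ge0 k); rewrite /lo /hi; lra.
have mlo : {homo lo : i j / (i <= j)%N >-> i <= j} by apply/nondecreasing_seqP.
have mhi : {homo hi : i j / (i <= j)%N >-> j <= i}.
  by apply/nonincreasing_seqP.
have lub i j : lo i <= hi j.
  have [ij|/ltnW ji] := leqP i j; first exact: le_trans (mlo _ _ ij) (lohi _).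
  exact: le_trans (lohi _) (mhi _ _ ji).
exists (sup (range lo)) => k.
have le1 : lo k <= sup (range lo).
  apply: ub_le_sup; last by exists k.
  by exists (hi 0) => _ [j _ <-].
have le2 : sup (range lo) <= hi k.
  apply: ge_sup; first by exists (lo 0), 0%N.
  by move=> _ [j _ <-].
rewrite ler_norml; move: le1 le2; rewrite /lo /hi; lra.
Qed.

Lemma modc_real x : md (x%:C) = `|x|.
Proof. by rewrite /modc /= expr0n addr0 sqrtr_sqr. Qed.

Lemma modc_sub z w : md (z - w) = md (w - z).
Proof. by rewrite -modcN opprB. Qed.

Lemma modcX z k : md (z ^+ k) = md z ^+ k.
Proof.
by elim: k => [|k IH]; rewrite ?expr0 ?modc1// !exprS modcM IH.
Qed.

Lemma modc_sum (I : Type) (r : seq I) (P : pred I) (F : I -> R[i]) :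
  md (\sum_(i <- r | P i) F i) <= \sum_(i <- r | P i) md (F i).
Proof.
elim/big_rec2: _ => [|i a b _ ab]; first by rewrite modc0.
by apply: le_trans (modcD _ _) _; rewrite lerD2l.
Qed.

Lemma modc_Re z : `|complex.Re z| <= md z.
Proof.
case: z => a b /=; rewrite -sqrtr_sqr ler_wsqrtr// lerDl; exact: sqr_ge0.
Qed.

Lemma modc_Im z : `|complex.Im z| <= md z.
Proof.
case: z => a b /=; rewrite -sqrtr_sqr ler_wsqrtr// lerDr; exact: sqr_ge0.
Qed.

Lemma modc_le_ReIm z : md z <= `|complex.Re z| + `|complex.Im z|.
Proof.
have {1}-> : z = (complex.Re z)%:C + 'i * (complex.Im z)%:C.
  exact: complexE.
apply: le_trans (modcD _ _) _; rewrite modc_real modcM modc_real.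
rewrite (_ : md 'i = 1) ?mul1r//.
by rewrite /modc /= expr0n add0r expr1n sqrtr1.
Qed.

(** [glim u l]: the sequence [u] converges to [l] at the rate of a geometric
    sequence of ratio one half. *)
Definition glim u l := exists c, forall k, md (u k - l) <= c * half k.

Lemma glim_cauchy u c : (forall k, md (u k.+1 - u k) <= c * half k) ->
  exists l, forall k, md (u k - l) <= 4 * c * half k.
Proof.
move=> uc.
have [k|a ua] := @real_geom_cauchy (fun k => complex.Re (u k)) c.
  by apply: le_trans (uc k); rewrite -raddfB; exact: modc_Re.
have [k|b ub] := @real_geom_cauchy (fun k => complex.Im (u k)) c.
  by apply: le_trans (uc k); rewrite -raddfB; exact: modc_Im.
exists (a +i* b)%C => k; apply: le_trans (modc_le_ReIm _) _.
rewrite !raddfB /=; move: (ua k) (ub k) => /=; lra.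
Qed.

Lemma glim_cst a : glim (fun=> a) a.
Proof. by exists 0 => k; rewrite subrr modc0 mul0r. Qed.

Lemma glimD u v l m : glim u l -> glim v m -> glim (fun k => u k + v k) (l + m).
Proof.
move=> [c uc] [d vd]; exists (c + d) => k; rewrite opprD addrACA.
by apply: le_trans (modcD _ _) _; rewrite mulrDl lerD.
Qed.

Lemma glimZ a u l : glim u l -> glim (fun k => a * u k) (a * l).
Proof.
move=> [c uc]; exists (md a * c) => k.
by rewrite -mulrBr modcM -mulrA ler_wpM2l ?modc_ge0.
Qed.

Lemma glimB u v l m : glim u l -> glim v m -> glim (fun k => u k - v k) (l - m).
Proof.
move=> ul vm; have := glimD ul (glimZ (-1) vm); rewrite mulN1r.
by congr glim; apply/funext => k; rewrite mulN1r.
Qed.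

Lemma glim_le u l x : glim u l ->
  (exists d, forall k, md (u k) <= x + d * half k) -> md l <= x.
Proof.
move=> [c uc] [d ux]; apply: (@le_of_half_exp (c + d)) => k.
rewrite -(subrK (u k) l); apply: le_trans (modcD _ _) _.
by rewrite modc_sub; move: (uc k) (ux k); lra.
Qed.

Lemma glim_bound u l x : glim u l -> (forall k, md (u k) <= x) -> md l <= x.
Proof. by move=> ul ux; apply: (glim_le ul); exists 0 => k; rewrite mul0r addr0. Qed.

Lemma glim_shift u l p : glim u l -> glim (fun k => u (k + p)%N) l.
Proof.
move=> [c uc]; exists c => k; apply: le_trans (uc _) _.
have c0 : 0 <= c by have := uc 0%N; rewrite expr0 mulr1; apply: le_trans; exact: modc_ge0.
rewrite exprD mulrA ler_piMr ?mulr_ge0 ?half_exp_ge0//.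
exact: half_exp_le1.
Qed.

Lemma glim_unique u l m : glim u l -> glim u m -> l = m.
Proof.
move=> ul um; apply/eqP; rewrite -subr_eq0; apply/eqP/modc0_eq0/eqP.
rewrite eq_le modc_ge0 andbT; apply: (glim_bound (glimB ul um)) => k.
by rewrite subrr modc0.
Qed.

End GeometricLimits.

(** * Peak polynomials on the unit disc *)

Section PeakPolynomials.
Variable R : realType.
Local Notation md z := (modc z : R).
Implicit Types (z w x : R[i]) (m k : nat).

(** Harmonic numbers. *)
Definition harm m : R := \sum_(k < m) k.+1%:R^-1.

Lemma harmS m : harm m.+1 = harm m + m.+1%:R^-1.
Proof. by rewrite /harm big_ord_recr. Qed.

Lemma harm_ge0 m : 0 <= harm m.
Proof. by apply: sumr_ge0 => k _; rewrite invr_ge0. Qed.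

Lemma harm_gt0 m : (0 < m)%N -> 0 < harm m.
Proof.
by case: m => // m _; rewrite harmS ltr_wpDl ?harm_ge0 ?invr_gt0.
Qed.

Lemma harm_le m n : (m <= n)%N -> harm m <= harm n.
Proof.
move=> /subnK <-; elim: (n - m)%N => [|k IH]; first by rewrite add0n.
by rewrite addSn harmS (le_trans IH)// lerDl invr_ge0.
Qed.

Lemma harm_unbounded (C : R) : exists2 m, (0 < m)%N & C <= harm m.
Proof.
have dv := @dvg_harmonic R.
have [m Cm] : exists m, C <= harm m.
  apply: contrapT => /forallNP nC; apply: dv.
  apply: (nondecreasing_is_cvgn (u_ := series harmonic)).
    by apply: nondecreasing_series => k _ _; exact: harmonic_ge0.
  exists C => _ [m _ <-]; have /negP := nC m; rewrite -ltNge => /ltW.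
  by rewrite /series /= /harmonic big_mkord.
by exists m.+1 => //; rewrite (le_trans Cm)// harm_le.
Qed.

(** Partial sums of the power series of [- log (1 - z)]. *)
Definition logsum m z : R[i] := \sum_(k < m) (k.+1%:R^-1 : R)%:C * z ^+ k.+1.

Lemma logsumS m z :
  logsum m.+1 z = logsum m z + (m.+1%:R^-1 : R)%:C * z ^+ m.+1.
Proof. by rewrite /logsum big_ord_recr. Qed.

(** The peak polynomial: it takes the value 1 at 1. *)
Definition peak m z : R[i] := ((harm m)^-1)%:C * logsum m z.

Lemma modc_1B_exp z k : md z <= 1 -> md (1 - z ^+ k) <= k%:R * md (1 - z).
Proof.
move=> z1; elim: k => [|k IH]; first by rewrite expr0 subrr modc0 mul0r.
have -> : 1 - z ^+ k.+1 = (1 - z ^+ k) + z ^+ k * (1 - z).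
  by rewrite exprSr; ring.
apply: le_trans (modcD _ _) _; rewrite -addn1 natrD mulrDl mul1r lerD//.
by rewrite modcM modcX ler_piMl ?modc_ge0// exprn_ile1 ?modc_ge0.
Qed.

(** Abel summation of the block of terms of index [a + 1, .., a + m]. *)
Lemma logsum_tail z a m : md z <= 1 ->
  md ((1 - z) * (logsum (a + m) z - logsum a z)
        + ((a + m).+1%:R^-1 : R)%:C * z ^+ (a + m).+1)
  <= 2 / a.+1%:R - (a + m).+1%:R^-1.
Proof.
move=> z1; elim: m => [|m IH].
  rewrite addn0 subrr mulr0 add0r modcM modcX modc_real ger0_norm ?invr_ge0//.
  apply: (@le_trans _ _ (a.+1%:R^-1)); last by set p := (a.+1%:R^-1 : R); lra.
  by rewrite ler_piMr ?invr_ge0// exprn_ile1 ?modc_ge0.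
rewrite addnS logsumS; set b := (a + m)%N in IH *.
set p : R := b.+1%:R^-1 in IH *; set q : R := b.+2%:R^-1.
have pq : q <= p by rewrite lef_pV2 ?posrE// ler_nat.
have -> : (1 - z) * (logsum b z + p%:C * z ^+ b.+1 - logsum a z) +
  q%:C * z ^+ b.+2 = ((1 - z) * (logsum b z - logsum a z) + p%:C * z ^+ b.+1)
     + (q - p)%:C * z ^+ b.+2.
  by rewrite [z ^+ b.+2]exprSr rmorphB; ring.
apply: le_trans (modcD _ _) _.
have : md ((q - p)%:C * z ^+ b.+2) <= p - q.
  rewrite modcM modcX modc_real ler0_norm ?subr_le0// opprB.
  by rewrite ler_piMr ?subr_ge0// exprn_ile1 ?modc_ge0.
by move: IH pq; clearbody p q; move: (a.+1%:R : R) => c; lra.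
Qed.

Lemma logsum_head z m : md z <= 1 ->
  md (logsum m z - (harm m)%:C) <= m%:R * md (1 - z).
Proof.
move=> z1; elim: m => [|m IH].
  by rewrite /logsum /harm !big_ord0 subrr modc0 mul0r.
rewrite logsumS harmS rmorphD opprD addrACA.
apply: le_trans (modcD _ _) _.
rewrite -[in leRHS]addn1 natrD mulrDl mul1r lerD//.
rewrite -[X in _ - X]mulr1 -mulrBr modcM modc_real ger0_norm ?invr_ge0//.
by rewrite modc_sub ler_pdivrMl// modc_1B_exp.
Qed.

(** The terms of index at most 1 / |1 - z| add up to a harmonic number, up to
    an error 1; the remaining ones have a sum of modulus at most 2. *)
Lemma logsum_near_segment z m : md z <= 1 ->
  exists2 s, 0 <= s <= harm m & md (logsum m z - s%:C) <= 3.
Proof.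
move=> z1; have [z_eq1|z_neq1] := eqVneq (1 - z) 0.
  exists (harm m); first by rewrite harm_ge0 lexx.
  by apply: le_trans (logsum_head m z1) _; rewrite z_eq1 modc0 mulr0.
have d0 : 0 < md (1 - z).
  rewrite lt_neqAle modc_ge0 andbT eq_sym.
  by apply: contra z_neq1 => /eqP/modc0_eq0 ->.
set d := md (1 - z) in d0 *.
pose M := Num.truncn d^-1.
have /andP[M1 M2] : M%:R <= d^-1 < M.+1%:R by apply: truncn_itv; rewrite invr_ge0 ltW.
have headM k : (k <= M)%N -> md (logsum k z - (harm k)%:C) <= 1.
  move=> kM; apply: le_trans (logsum_head k z1) _.
  rewrite -ler_pdivlMr// div1r (le_trans _ M1)// ler_nat//.
have [mM|Mm] := leqP m M.
  exists (harm m); first by rewrite harm_ge0 lexx.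
  by rewrite (le_trans (headM _ mM))// ler1n.
exists (harm M); first by rewrite harm_ge0 harm_le// ltnW.
have tail : md (logsum m z - logsum M z) <= 2.
  have := logsum_tail M (m - M) z1; rewrite subnKC ?(ltnW Mm)// => H.
  set E := _ * z ^+ _ in H.
  have E1 : md E <= m.+1%:R^-1.
    rewrite /E modcM modcX modc_real ger0_norm ?invr_ge0//.
    by rewrite ler_piMr ?invr_ge0// exprn_ile1 ?modc_ge0.
  have : md ((1 - z) * (logsum m z - logsum M z)) <= 2 / M.+1%:R.
    rewrite -(addrK E (_ * _)); apply: le_trans (modcD _ _) _.
    by rewrite modcN; move: H E1; move: (m.+1%:R : R) (M.+1%:R : R) => c c'; lra.
  rewrite modcM -/d -ler_pdivlMl// => /le_trans; apply.
  rewrite mulrCA ler_piMr// ler_pdivrMr// mul1r; exact: ltW.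
rewrite -(subrKA (logsum M z)); apply: le_trans (modcD _ _) _.
by have := headM M (leqnn M); lra.
Qed.

(** On the closed disc the peak polynomial takes its values close to the
    segment [0, 1]. *)
Lemma peak_segment z m : md z <= 1 -> (0 < m)%N ->
  md (1 - peak m z) + md (peak m z) <= 1 + 6 / harm m.
Proof.
move=> z1 m0; have H0 := harm_gt0 m0.
have [s /andP[s0 s1] sz] := logsum_near_segment m z1.
pose t := (harm m)^-1 * s.
have t0 : 0 <= t by rewrite mulr_ge0// invr_ge0 ltW.
have t1 : t <= 1 by rewrite /t ler_pdivrMl ?mulr1.
have pt : md (peak m z - t%:C) <= 3 / harm m.
  rewrite /t rmorphM -mulrBr modcM modc_real ger0_norm ?invr_ge0 ?(ltW H0)//.
  by rewrite mulrC ler_wpM2r ?invr_ge0 ?(ltW H0).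
have a1 : md (peak m z) <= 3 / harm m + t.
  rewrite -(subrK t%:C (peak m z)); apply: le_trans (modcD _ _) _.
  by rewrite modc_real (ger0_norm t0) lerD2r.
have a2 : md (1 - peak m z) <= 3 / harm m + (1 - t).
  have -> : 1 - peak m z = (1 - t)%:C + (t%:C - peak m z).
    by rewrite rmorphB rmorph1 subrKA.
  apply: le_trans (modcD _ _) _.
  by rewrite modc_real ger0_norm ?subr_ge0// addrC lerD2r modc_sub.
by move: a1 a2; lra.
Qed.

Lemma geom_sum_le (r : R) m : 0 <= r < 1 -> \sum_(k < m) r ^+ k <= (1 - r)^-1.
Proof.
move=> /andP[r0 r1]; have r1' : 0 < 1 - r by rewrite subr_gt0.
rewrite -[leRHS]mul1r ler_pdivlMr// mulrC.
by rewrite -opprB mulNr -subrX1 opprB gerDl oppr_le0 exprn_ge0.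
Qed.

Lemma geom_dsum_le (r : R) m : 0 <= r < 1 ->
  \sum_(k < m) k.+1%:R * r ^+ k <= ((1 - r) ^+ 2)^-1.
Proof.
move=> /andP[r0 r1]; have r1' : 0 < 1 - r by rewrite subr_gt0.
rewrite -[leRHS]mul1r ler_pdivlMr ?exprn_gt0//.
have -> : (\sum_(k < m) k.+1%:R * r ^+ k) * (1 - r) ^+ 2 =
    1 - r ^+ m * (1 + m%:R * (1 - r)).
  elim: m => [|m IH]; first by rewrite big_ord0 expr0; ring.
  by rewrite big_ord_recr /= mulrDl IH [r ^+ m.+1]exprS; ring.
by rewrite gerBl mulr_ge0 ?exprn_ge0// addr_ge0// mulr_ge0// ltW.
Qed.

Lemma peak_small (r : R) m z : 0 <= r < 1 -> md z <= r ->
  md (peak m z) <= (harm m)^-1 / (1 - r).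
Proof.
move=> /andP[r0 r1] zr.
rewrite /peak modcM modc_real ger0_norm ?invr_ge0 ?harm_ge0//.
apply: ler_wpM2l; first by rewrite invr_ge0 harm_ge0.
apply: le_trans (modc_sum _ _ _) _.
apply: le_trans (geom_sum_le m _); last by rewrite r0.
apply: ler_sum => k _; rewrite modcM modcX modc_real ger0_norm ?invr_ge0//.
apply: (@le_trans _ _ (md z ^+ k.+1)).
  by rewrite ler_piMl ?exprn_ge0 ?modc_ge0// invf_le1// ler1n.
rewrite exprSr (@le_trans _ _ (md z ^+ k))//.
  by rewrite ler_piMr ?exprn_ge0 ?modc_ge0// (le_trans zr)// ltW.
by apply: lerXn2r; rewrite ?nnegrE ?modc_ge0.
Qed.

Lemma peak_at1 (e : R) m : (0 < m)%N -> 0 < e ->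
  exists2 s : R, s < 1 & forall t : R, s < t < 1 -> 0 <= t ->
    md (1 - peak m t%:C) <= e.
Proof.
move=> m0 e0; have H0 := harm_gt0 m0.
have c0 : 0 < (harm m)^-1 * m%:R by rewrite mulr_gt0 ?invr_gt0 ?ltr0n.
exists (1 - e / ((harm m)^-1 * m%:R)).
  by rewrite gtrDl oppr_lt0 divr_gt0.
move=> t /andP[st t1] t0.
have mt : md t%:C <= 1 by rewrite modc_real ger0_norm// ltW.
have -> : 1 - peak m t%:C = ((harm m)^-1)%:C * ((harm m)%:C - logsum m t%:C).
  by rewrite mulrBr -rmorphM mulVf ?gt_eqF// rmorph1.
rewrite modcM modc_real ger0_norm ?invr_ge0 ?harm_ge0//.
rewrite modc_sub (le_trans (ler_wpM2l _ (logsum_head m mt)))//.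
  by rewrite invr_ge0 harm_ge0.
rewrite mulrA (_ : 1 - t%:C = (1 - t)%:C); last by rewrite rmorphB rmorph1.
rewrite modc_real ger0_norm ?subr_ge0 ?(ltW t1)//.
by rewrite -ler_pdivlMl// mulrC; move: st; lra.
Qed.

(** The derivative of the peak polynomial. *)
Definition dpeak m z : R[i] := ((harm m)^-1)%:C * \sum_(k < m) z ^+ k.

(** The second-order Taylor remainder of a power; both sides carry a factor
    [r] so that no exponent is decreased. *)
Lemma expr_taylor (r : R) k z x : md z + md x <= r ->
  md ((z + x) ^+ k.+1 - z ^+ k.+1 - k.+1%:R * z ^+ k * x) * r
  <= k%:R * k.+1%:R * r ^+ k * md x ^+ 2.
Proof.
move=> zxr; have r0 : 0 <= r by rewrite (le_trans _ zxr)// addr_ge0 ?modc_ge0.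
have zr : md z <= r by rewrite (le_trans _ zxr)// lerDl modc_ge0.
elim: k => [|k IH].
  by rewrite [X in modc X](_ : _ = 0) ?modc0 ?mul0r//; ring.
set A := (X in md X * r) in IH.
have -> : (z + x) ^+ k.+2 - z ^+ k.+2 - k.+2%:R * z ^+ k.+1 * x =
    (z + x) * A + k.+1%:R * z ^+ k * x ^+ 2.
  rewrite /A [(z + x) ^+ k.+2]exprS [z ^+ k.+2]exprS [z ^+ k.+1]exprS.
  by rewrite -[k.+2]addn1 natrD; ring.
have kE : md (k.+1%:R : R[i]) = k.+1%:R.
  by rewrite -(rmorph_nat (real_complex R)) modc_real ger0_norm.
apply: (@le_trans _ _ ((r * md A + k.+1%:R * r ^+ k * md x ^+ 2) * r)).
  apply: ler_wpM2r => //; apply: le_trans (modcD _ _) _; apply: lerD.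
    rewrite modcM ler_wpM2r ?modc_ge0//.
    by rewrite (le_trans (modcD _ _)).
  rewrite !modcM !modcX kE; apply: ler_wpM2r; first by rewrite mulr_ge0 ?modc_ge0.
  apply: ler_wpM2l => //.
  by apply: lerXn2r; rewrite ?nnegrE ?modc_ge0.
have -> : k.+2%:R = k%:R + 2 :> R by rewrite -addn2 natrD.
have K1 : k.+1%:R = k%:R + 1 :> R by rewrite -natr1.
have := mulr_ge0 (mulr_ge0 r0 (exprn_ge0 k r0)) (sqr_ge0 (md x)).
have := ler_wpM2l r0 IH; have : 0 <= k%:R :> R by [].
rewrite K1 [r ^+ k.+1]exprS.
move: (modc A) (modc x) (r ^+ k) (k%:R : R) => a y P K K0 H1 H2.
have := mulr_ge0 K0 H2; nra.
Qed.

Lemma dpeak_le (r : R) m z : 0 <= r < 1 -> md z <= r ->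
  md (dpeak m z) <= (harm m)^-1 / (1 - r).
Proof.
move=> /andP[r0 r1] zr.
rewrite /dpeak modcM modc_real ger0_norm ?invr_ge0 ?harm_ge0//.
apply: ler_wpM2l; first by rewrite invr_ge0 harm_ge0.
apply: le_trans (modc_sum _ _ _) _.
apply: le_trans (geom_sum_le m _); last by rewrite r0.
apply: ler_sum => k _; rewrite modcX.
by apply: lerXn2r; rewrite ?nnegrE ?modc_ge0.
Qed.

Lemma peak_taylor (r : R) m z x : 2^-1 <= r < 1 -> md z + md x <= r ->
  md (peak m (z + x) - peak m z - dpeak m z * x)
  <= (harm m)^-1 * (2 / (1 - r) ^+ 2) * md x ^+ 2.
Proof.
move=> /andP[r2 r1] zxr; have r0 : 0 < r by rewrite (lt_le_trans _ r2)// invr_gt0.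
rewrite /peak /dpeak -mulrA -!mulrBr modcM modc_real.
rewrite ger0_norm ?invr_ge0 ?harm_ge0// -mulrA.
apply: ler_wpM2l; first by rewrite invr_ge0 harm_ge0.
rewrite /logsum mulr_suml -!sumrB; apply: le_trans (modc_sum _ _ _) _.
apply: (@le_trans _ _ ((\sum_(k < m) k.+1%:R * r ^+ k) * (2 * md x ^+ 2))).
  rewrite mulr_suml; apply: ler_sum => k _.
  have kk : (k.+1%:R^-1 : R)%:C * k.+1%:R = 1.
    by rewrite -(rmorph_nat (real_complex R)) -rmorphM mulVf ?pnatr_eq0.
  have -> : (k.+1%:R^-1)%:C * (z + x) ^+ k.+1 - (k.+1%:R^-1)%:C * z ^+ k.+1
     - z ^+ k * x = (k.+1%:R^-1 : R)%:C *
       ((z + x) ^+ k.+1 - z ^+ k.+1 - k.+1%:R * z ^+ k * x).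
    by rewrite !mulrBr !mulrA kk mul1r.
  rewrite modcM modc_real ger0_norm ?invr_ge0// ler_pdivrMl//.
  have := expr_taylor k zxr; set A := modc _; rewrite -ler_pdivlMr// => /le_trans; apply.
  rewrite ler_pdivrMr//.
  rewrite -subr_ge0 (_ : _ - _ = k.+1%:R * r ^+ k * md x ^+ 2
     * (k.+1%:R * (2 * r) - k%:R)); last by ring.
  rewrite mulr_ge0//.
    by rewrite !mulr_ge0 ?exprn_ge0 ?modc_ge0// ltW.
  rewrite subr_ge0 (@le_trans _ _ (k.+1%:R))// ?ler_nat//.
  by rewrite ler_peMr// -ler_pdivrMl// mulr1.
rewrite [leRHS](_ : _ = ((1 - r) ^+ 2)^-1 * (2 * md x ^+ 2)); last by ring.
apply: ler_wpM2r; first by rewrite mulr_ge0 ?sqr_ge0.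
by apply: geom_dsum_le; rewrite (ltW r0).
Qed.

End PeakPolynomials.

(** * Norming functionals *)

Section NormingFunctional.
Variables (R : realType) (n : nat).
Local Notation V := 'rV[R[i]]_n.
Implicit Types (p q : V -> R) (x y e : V).

(** Real sublinear functionals on [C^n]. *)
Definition sublinear p := (forall x y, p (x + y) <= p x + p y) /\
  (forall (t : R) x, 0 <= t -> p (t%:C *: x) <= t * p x).

Lemma sublinear0 p : sublinear p -> p 0 = 0.
Proof.
move=> [pD pZ]; apply/eqP; rewrite eq_le; apply/andP; split.
  by have := pZ 0 0 (lexx _); rewrite scaler0 mul0r.
by have := pD 0 0; rewrite addr0; lra.
Qed.

Lemma sublinearZ p (t : R) x : sublinear p -> 0 <= t -> p (t%:C *: x) = t * p x.
Proof.
move=> sp; have [pD pZ] := sp.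
rewrite le_eqVlt => /orP[/eqP <-|t0]; first by rewrite scale0r mul0r sublinear0.
apply/eqP; rewrite eq_le (pZ _ _ (ltW t0)) /= -ler_pdivlMl//.
have t'0 : 0 <= t^-1 by rewrite invr_ge0 ltW.
apply: le_trans (pZ _ _ t'0).
by rewrite scalerA -rmorphM mulVf ?gt_eqF// scale1r.
Qed.

(** The largest sublinear minorant of [p] that is linear along [e], in the
    sense that it takes the value [- p e] at [- e]. *)
Definition linearize p e x : R :=
  inf [set p (x + t%:C *: e) - t * p e | t in [set t | 0 <= t]].

Lemma linearize_lb p e x (t : R) : sublinear p -> 0 <= t ->
  - p (- x) <= p (x + t%:C *: e) - t * p e.
Proof.
move=> sp t0; have [pD pZ] := sp.
have := pD (x + t%:C *: e) (- x); rewrite addrAC subrr add0r sublinearZ//; lra.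
Qed.

Lemma linearize_le p e x (t : R) : sublinear p -> 0 <= t ->
  linearize p e x <= p (x + t%:C *: e) - t * p e.
Proof.
move=> sp t0; apply: ge_inf; last by exists t.
by exists (- p (- x)) => _ [s s0 <-]; exact: linearize_lb.
Qed.

Lemma linearize_ge p e x c : sublinear p ->
  (forall t : R, 0 <= t -> c <= p (x + t%:C *: e) - t * p e) ->
  c <= linearize p e x.
Proof.
move=> sp cx; apply: lb_le_inf; last first.
  by move=> _ [t t0 <-]; exact: cx.
by exists (p (x + 0%:C *: e) - 0 * p e); exists 0 => //=.
Qed.

Lemma linearize_le_id p e x : sublinear p -> linearize p e x <= p x.
Proof.
move=> sp; have := linearize_le e x sp (lexx 0).
by rewrite scale0r addr0 mul0r subr0.
Qed.

Lemma linearizeN p e : sublinear p -> linearize p e (- e) <= - p e.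
Proof.
move=> sp; have := linearize_le e (- e) sp ler01.
by rewrite rmorph1 scale1r addNr sublinear0// mul1r sub0r.
Qed.

Lemma linearize_sublinear p e : sublinear p -> sublinear (linearize p e).
Proof.
move=> sp; have [pD pZ] := sp; split=> [x y|t x t0].
  rewrite -lerBlDr; apply: linearize_ge => // t t0.
  rewrite lerBlDl -lerBlDr; apply: linearize_ge => // s s0.
  rewrite lerBlDr; have := linearize_le e (x + y) sp (addr_ge0 s0 t0).
  have := pD (y + s%:C *: e) (x + t%:C *: e).
  by rewrite addrACA -scalerDl -rmorphD (addrC y); lra.
move: t0; rewrite le_eqVlt => /orP[/eqP <-|t0].
  by rewrite scale0r mul0r (le_trans (linearize_le_id _ _ sp))// sublinear0.
rewrite -ler_pdivrMl//; apply: linearize_ge => // s s0.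
rewrite ler_pdivrMl//; have := linearize_le e (t%:C *: x) sp (mulr_ge0 (ltW t0) s0).
rewrite rmorphM -scalerA -scalerDr => /le_trans; apply.
by rewrite sublinearZ// ?(ltW t0)// mulrBr mulrA.
Qed.

(** A sublinear functional is linear on the subspace of its lineal vectors. *)
Definition lineal p e := p e + p (- e) <= 0.

Lemma lineal_le p q e : (forall x, q x <= p x) -> lineal p e -> lineal q e.
Proof. by move=> qp; apply: le_trans; rewrite lerD. Qed.

(** Linearizing successively along the vectors of [s]: the directions already
    treated remain lineal, because [lineal] passes to sublinear minorants. *)
Lemma lineal_seq (s : seq V) p : sublinear p ->
  exists q, [/\ sublinear q, forall x, q x <= p x & forall e, e \in s -> lineal q e].
Proof.
elim: s p => [|e s IH] p sp; first by exists p.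
have [q [sq qp qs]] := IH _ (linearize_sublinear e sp).
exists q; split => // [x|f].
  by apply: le_trans (qp x) _; exact: linearize_le_id.
rewrite in_cons => /orP[/eqP ->|/qs//].
apply: (lineal_le qp); rewrite /lineal.
by have := linearize_le_id e e sp; have := linearizeN e sp; lra.
Qed.

Lemma linealD p e f : sublinear p -> lineal p e -> lineal p f -> lineal p (e + f).
Proof.
move=> [pD _]; rewrite /lineal opprD.
by have := pD e f; have := pD (- e) (- f); lra.
Qed.

Lemma linealZ p e (t : R) : sublinear p -> lineal p e -> lineal p (t%:C *: e).
Proof.
move=> sp le; wlog t0 : t / 0 <= t => [H|].
  have [/H//|/ltW t0] := leP 0 t; have := H (- t).
  rewrite /lineal rmorphN scaleNr opprK addrC; apply.
  by rewrite oppr_ge0.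
by rewrite /lineal -scalerN !sublinearZ// -mulrDr mulr_ge0_le0.
Qed.

Lemma linealP p : sublinear p ->
  (forall i, lineal p (delta_mx 0 i)) -> (forall i, lineal p ('i%C *: delta_mx 0 i)) ->
  forall x, lineal p x.
Proof.
move=> sp p1 pi x; rewrite (row_sum_delta x); elim/big_rec: _ => [|i y _ IH].
  by rewrite /lineal oppr0 sublinear0// addr0.
apply: linealD => //; rewrite (complexE (x 0 i)) scalerDl mulrC -scalerA.
by apply: linealD => //; apply: linealZ.
Qed.

(** Linearizing first along [x0] yields a real-linear minorant of [p] that
    agrees with [p] at [x0]. *)
Lemma real_functional p x0 : sublinear p ->
  exists u : V -> R, [/\ forall x y, u (x + y) = u x + u y,
    forall (t : R) x, u (t%:C *: x) = t * u x,
    forall x, u x <= p x & u x0 = p x0].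
Proof.
move=> sp; pose s : seq V := [seq delta_mx 0 i | i <- enum 'I_n] ++
  [seq 'i%C *: delta_mx 0 i | i <- enum 'I_n].
have [u [su up us]] := lineal_seq s (linearize_sublinear x0 sp).
have lu x : lineal u x.
  apply: linealP => // i; apply: us; rewrite mem_cat; apply/orP.
    by left; apply/mapP; exists i; rewrite ?mem_enum.
  by right; apply/mapP; exists i; rewrite ?mem_enum.
have [uD _] := su.
have uN x : u (- x) = - u x.
  have := lu x; rewrite /lineal; have := uD x (- x).
  by rewrite subrr sublinear0//; lra.
have up' x : u x <= p x by apply: le_trans (up x) _; exact: linearize_le_id.
exists u; split => // [x y|t x|].
- apply/eqP; rewrite eq_le uD /=; have := uD (x + y) (- y).
  by rewrite addrK uN; lra.
- have [t0|/ltW t0] := leP 0 t; first by rewrite sublinearZ.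
  rewrite -[t]opprK rmorphN scaleNr uN sublinearZ ?oppr_ge0//.
  by rewrite !mulNr.
- apply/eqP; rewrite eq_le up' /= -[X in _ <= X]opprK lerNr -uN.
  by apply: le_trans (up _) _; exact: linearizeN.
Qed.

(** Hahn-Banach: a unit vector is normed by a complex-linear functional. *)
Lemma norming_functional (N : cnorm R n) z : N z = 1 ->
  exists l : V -> R[i], [/\ forall (a : R[i]) x y, l (a *: x + y) = a * l x + l y,
    forall x, modc (l x) <= N x & l z = 1].
Proof.
move=> Nz.
have sN : sublinear N.
  split=> [|t x t0]; first exact: cnormD.
  by rewrite cnormZ modc_real ger0_norm.
have [u [uD uZ uN uz]] := real_functional z sN.
(* The complex-linear functional with real part [u]. *)
pose l x : R[i] := (u x)%:C - 'i%C * (u ('i%C *: x))%:C.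
have ii : 'i%C * 'i%C = -1 :> R[i] by rewrite -expr2 sqr_i.
have uc (a : R[i]) x : u (a *: x) = complex.Re a * u x + complex.Im a * u ('i%C *: x).
  rewrite {1}(complexE a) scalerDl uD uZ; congr (_ + _).
  by rewrite mulrC -scalerA uZ.
have lZ a x : l (a *: x) = a * l x.
  rewrite /l scalerA uc [u (('i%C * a) *: x)]uc.
  have -> : complex.Re ('i%C * a) = - complex.Im a.
    by case: a => b c /=; rewrite mul0r sub0r mul1r.
  have -> : complex.Im ('i%C * a) = complex.Re a.
    by case: a => b c /=; rewrite mul0r add0r mul1r.
  rewrite {5}(complexE a).
  move: (complex.Re a) (complex.Im a) (u x) (u ('i%C *: x)) => b c v w.
  rewrite !rmorphD !rmorphM !rmorphN /=.
  apply/eqP; rewrite -subr_eq0.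
  rewrite (_ : _ - _ = (1 + 'i%C * 'i%C) * c%:C * w%:C); last by ring.
  by rewrite ii subrr !mul0r.
have lD x y : l (x + y) = l x + l y.
  by rewrite /l scalerDr !uD !rmorphD; ring.
have lN x : modc (l x) <= N x.
  have [->|lx0] := eqVneq (l x) 0; first by rewrite modc0 cnorm_ge0.
  have m0 : modc (l x) != 0 by apply: contra lx0 => /eqP/modc0_eq0 ->.
  have := modcE (l x); set m := modc _ in m0 *; move=> mE.
  (* Rotating [x] makes [l x] real and nonnegative. *)
  pose a := m%:C / l x.
  have ma : modc a = 1.
    rewrite /a modcM ComplexField.Normc.normcV modc_real ger0_norm ?modc_ge0//.
    by rewrite mulfV.
  have : l (a *: x) = m%:C by rewrite lZ /a mulfVK.
  move=> /(congr1 (@complex.Re R)) /=.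
  rewrite /l raddfB /= mul0r mul1r => Hm.
  have -> : N x = N (a *: x) by rewrite cnormZ ma mul1r.
  by apply: le_trans (uN _); rewrite -Hm; lra.
exists l; split => //; first by move=> a x y; rewrite lD lZ.
(* [l z] has real part 1 and modulus at most 1. *)
have Rlz : complex.Re (l z) = 1.
  by rewrite /l raddfB /= uz Nz; ring.
have := lN z; rewrite Nz; case: (l z) Rlz => a b /= -> {a}.
rewrite expr1n => H.
have : 1 + b ^+ 2 <= 1.
  rewrite -(@ler_sqrt R)//; first by rewrite sqrtr1.
by rewrite gerDl => b2; congr (_ +i* _)%C; apply/eqP; rewrite -sqrf_eq0 eq_le b2 sqr_ge0.
Qed.

End NormingFunctional.

(** * Second-order jets and differentiability *)

Lemma differentiable_linear_approx (K : numFieldType) (V W : normedModType K)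
    (f : V -> W) (D : {linear V -> W}) (x : V) : continuous D ->
  (forall e : K, 0 < e ->
    exists2 q, 0 < q & forall h, `|h| <= q ->
    `|f (h + x) - (f x + D h)| <= e * `|h|) ->
  differentiable f x.
Proof.
move=> Dc H; have fE : f \o shift x = cst (f x) + D +o_ 0 id.
  apply/eqaddoP => e /H[q q0 Hq].
  by apply: filterS (nbhs0_le q0).
by apply/diff_locallyP; rewrite (diff_unique Dc fE); split.
Qed.

Section Jets.
Variables (R : realType) (n : nat) (N : cnorm R n).
Local Notation V := 'rV[R[i]]_n.
Local Notation md z := (modc z : R).
Implicit Types (g f : V -> R[i]) (d : V -> R[i]) (x h : V).

(** [jet x0 r K g d]: the value and the derivative [d] of [g] at [x0], and its
    second-order Taylor remainder on the ball of radius [r], are all bounded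
    by [K]. *)
Definition jet x0 (r K : R) g d := [/\ modc (g x0) <= K,
  forall (a : R[i]) x y, d (a *: x + y) = a * d x + d y,
  forall h, modc (d h) <= K * N h &
  forall h, N h <= r -> modc (g (x0 + h) - g x0 - d h) <= K * N h ^+ 2].

Lemma jet_ge0 x0 r K g d : jet x0 r K g d -> 0 <= K.
Proof. by case=> + _ _ _; apply: le_trans; exact: modc_ge0. Qed.

Lemma jet_cst x0 r (w : R[i]) : jet x0 r (modc w) (fun=> w) (fun=> 0).
Proof.
split=> // [a x y|h|h _]; first by rewrite mulr0 addr0.
  by rewrite modc0 mulr_ge0 ?modc_ge0 ?cnorm_ge0.
by rewrite subrr subr0 modc0 mulr_ge0 ?modc_ge0 ?sqr_ge0.
Qed.

Lemma jetD x0 r K K' g g' d d' : jet x0 r K g d -> jet x0 r K' g' d' ->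
  jet x0 r (K + K') (fun x => g x + g' x) (fun h => d h + d' h).
Proof.
move=> [g1 g2 g3 g4] [h1 h2 h3 h4]; split=> [|a x y|h|h hr].
- by apply: le_trans (modcD _ _) _; rewrite lerD.
- by rewrite g2 h2; ring.
- by apply: le_trans (modcD _ _) _; rewrite mulrDl lerD.
- rewrite mulrDl; apply: le_trans (lerD (g4 h hr) (h4 h hr)).
  by apply: le_trans (modcD _ _); rewrite le_eqVlt; apply/orP; left; apply/eqP;
    congr modc; ring.
Qed.

Lemma jet_le x0 r K K' g d : K <= K' -> jet x0 r K g d -> jet x0 r K' g d.
Proof.
move=> KK [g1 g2 g3 g4]; split=> // [|h|h hr]; first exact: le_trans KK.
  by apply: le_trans (g3 h) _; rewrite ler_wpM2r ?cnorm_ge0.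
by apply: le_trans (g4 h hr) _; rewrite ler_wpM2r ?sqr_ge0.
Qed.

(** The constant 6 bounds the terms of a product of two expansions; this uses
    that the radius is at most 1. *)
Lemma jetM x0 r K K' g g' d d' : r <= 1 ->
  jet x0 r K g d -> jet x0 r K' g' d' ->
  jet x0 r (6 * (K * K')) (fun x => g x * g' x)
    (fun h => g x0 * d' h + g' x0 * d h).
Proof.
move=> r1 G G'; have K0 := jet_ge0 G; have K'0 := jet_ge0 G'.
have KK0 := mulr_ge0 K0 K'0.
case: G => [g1 g2 g3 g4]; case: G' => [h1 h2 h3 h4]; split=> [|a x y|h|h hr].
- rewrite modcM (@le_trans _ _ (K * K'))//; first by rewrite ler_pM ?modc_ge0.
  lra.
- by rewrite g2 h2; ring.
- apply: le_trans (modcD _ _) _; rewrite !modcM.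
  have a1 : md (g x0) * md (d' h) <= K * (K' * N h) by rewrite ler_pM ?modc_ge0.
  have a2 : md (g' x0) * md (d h) <= K' * (K * N h) by rewrite ler_pM ?modc_ge0.
  by have := mulr_ge0 KK0 (cnorm_ge0 N h); lra.
- have Nh0 := cnorm_ge0 N h.
  set e := g (x0 + h) - g x0 - d h; set e' := g' (x0 + h) - g' x0 - d' h.
  have e_le : md e <= K * N h ^+ 2 := g4 h hr.
  have e'_le : md e' <= K' * N h ^+ 2 := h4 h hr.
  have -> : g (x0 + h) * g' (x0 + h) - g x0 * g' x0 - (g x0 * d' h + g' x0 * d h)
    = g x0 * e' + g' x0 * e + (d h + e) * (d' h + e') by rewrite /e /e'; ring.
  have Nh1 : N h <= 1 := le_trans hr r1.
  have N2 : N h ^+ 2 <= N h by rewrite expr2 ler_piMr.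
  have f_le : md (d h + e) <= K * (2 * N h).
    apply: le_trans (modcD _ _) _.
    by have := g3 h; have := ler_wpM2l K0 N2; move: e_le; lra.
  have f'_le : md (d' h + e') <= K' * (2 * N h).
    apply: le_trans (modcD _ _) _.
    by have := h3 h; have := ler_wpM2l K'0 N2; move: e'_le; lra.
  have b1 : md (g x0 * e') <= K * (K' * N h ^+ 2) by rewrite modcM ler_pM ?modc_ge0.
  have b2 : md (g' x0 * e) <= K' * (K * N h ^+ 2) by rewrite modcM ler_pM ?modc_ge0.
  have b3 : md ((d h + e) * (d' h + e')) <= K * (2 * N h) * (K' * (2 * N h)).
    by rewrite modcM ler_pM ?modc_ge0.
  apply: le_trans (modcD _ _) _.
  apply: le_trans (lerD (modcD _ _) (lexx _)) _.
  apply: le_trans (lerD (lerD b1 b2) b3) _.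
  by rewrite le_eqVlt; apply/orP; left; apply/eqP; ring.
Qed.

(** The jet of a peak function is controlled by the inverse of a harmonic
    number, uniformly in the degree away from the sphere. *)
Lemma jet_peak x0 r (s : R) (l : V -> R[i]) m :
  (forall (a : R[i]) x y, l (a *: x + y) = a * l x + l y) ->
  (forall x, modc (l x) <= N x) ->
  2^-1 <= s < 1 -> N x0 + r <= s -> 0 <= r ->
  jet x0 r ((harm R m)^-1 * (2 / (1 - s) ^+ 2)) (fun x => peak m (l x))
    (fun h => dpeak m (l x0) * l h).
Proof.
move=> lin lN sP Nr r0; have /andP[s2 s1] := sP.
have s0 : 0 <= s by rewrite (le_trans _ s2)// invr_ge0.
have t0 : 0 < 1 - s by rewrite subr_gt0.
have H0 := harm_ge0 R m.
have l0 : modc (l x0) <= s.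
  by apply: le_trans (lN _) _; apply: le_trans Nr; rewrite lerDl.
have le2 : (1 - s)^-1 <= 2 / (1 - s) ^+ 2.
  rewrite expr2 invfM mulrA ler_peMl ?invr_ge0 ?(ltW t0)//.
  by rewrite ler_pdivlMr// mul1r; lra.
have le3 : (harm R m)^-1 / (1 - s) <= (harm R m)^-1 * (2 / (1 - s) ^+ 2).
  by rewrite ler_wpM2l ?invr_ge0.
split=> [|a x y|h|h hr].
- by apply: le_trans le3; apply: peak_small => //; rewrite s0.
- by rewrite lin; ring.
- rewrite modcM; apply: ler_pM; rewrite ?modc_ge0//.
  by apply: le_trans le3; apply: dpeak_le => //; rewrite s0.
- have -> : l (x0 + h) = l x0 + l h by have := lin 1 x0 h; rewrite scale1r mul1r.
  apply: (@le_trans _ _ ((harm R m)^-1 * (2 / (1 - s) ^+ 2) * md (l h) ^+ 2)).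
    apply: peak_taylor => //; apply: le_trans Nr; apply: lerD => //.
    exact: le_trans (lN h) hr.
  apply: ler_wpM2l; last by apply: lerXn2r; rewrite ?nnegrE ?modc_ge0 ?cnorm_ge0.
  by rewrite mulr_ge0 ?invr_ge0// divr_ge0 ?sqr_ge0.
Qed.

Lemma jet_differentiable f d x0 (r K : R) : 0 < r -> jet x0 r K f d ->
  differentiable f x0.
Proof.
move=> r0 J; have K0 := jet_ge0 J; case: J => _ dlin dK fd.
have [C C0 NC] := cnorm_le_mx_norm N.
have dl : linear (d : V -> R[i]) by move=> a x y; exact: dlin.
pose D : {linear V -> R[i]} := HB.pack d (GRing.isLinear.Build R[i] V R[i] *:%R d dl).
have DE x : D x = d x by [].
have Dc : continuous D.
  apply: bounded_linear_continuous; apply/linear_boundedP.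
  near=> M => x; rewrite DE modcE.
  apply: (@le_trans _ _ ((K * N x)%:C)); first by rewrite lecR.
  rewrite rmorphM; apply: (@le_trans _ _ (K%:C * (C%:C * `|x|))).
    by apply: ler_wpM2l; [rewrite ler0c|exact: NC].
  rewrite mulrA -rmorphM ler_wpM2r//.
  by near: M; apply: nbhs_pinfty_ge; rewrite realE ler0c mulr_ge0// ltW.
apply: (differentiable_linear_approx Dc) => e e0.
have eR : e = (complex.Re e)%:C by rewrite RRe_real// realE ltW.
have e0' : 0 < complex.Re e by move: e0; rewrite {1}eR ltcR.
pose q := Num.min (r / C) (complex.Re e / (C ^+ 2 * (K + 1))).
have K1 : 0 < K + 1 by rewrite ltr_wpDl.
have q0 : 0 < q.
  by rewrite lt_min !divr_gt0// mulr_gt0// exprn_gt0.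
exists q%:C; rewrite ?ltcR// => h hq.
have [c hc c0] : exists2 c : R, `|h| = c%:C & 0 <= c.
  have h_re : `|h| \is Num.real by rewrite realE normr_ge0.
  exists (complex.Re `|h|); first by rewrite RRe_real.
  by rewrite -ler0c RRe_real.
have bc : N h <= C * c by have := NC h; rewrite hc -rmorphM lecR.
have cq : c <= q by move: hq; rewrite hc lecR.
have hr : N h <= r.
  apply: le_trans bc _; rewrite -ler_pdivlMl// mulrC.
  by apply: le_trans cq _; rewrite ge_min lexx.
rewrite opprD addrA [h + x0]addrC hc eR -rmorphM modcE lecR.
apply: le_trans (fd h hr) _.
apply: (@le_trans _ _ ((K + 1) * (C * c) ^+ 2)).
  apply: ler_pM => //; first by rewrite sqr_ge0.
    by rewrite lerDl.
  by apply: lerXn2r => //; rewrite nnegrE ?cnorm_ge0// mulr_ge0// ltW.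
rewrite exprMn expr2 [c ^+ 2]expr2 !mulrA ler_wpM2r//.
have : c <= complex.Re e / (C ^+ 2 * (K + 1)).
  by apply: le_trans cq _; rewrite ge_min lexx orbT.
by rewrite ler_pdivlMr ?mulr_gt0 ?exprn_gt0//; nra.
Unshelve. all: by end_near. Qed.

End Jets.

(** * The interpolating iteration *)

Section LimitOfJets.
Variables (R : realType) (n : nat) (N : cnorm R n).
Local Notation V := 'rV[R[i]]_n.
Local Notation md z := (modc z : R).
Local Notation half k := ((2^-1 : R) ^+ k).

(** A series of functions whose jets are geometrically small has a
    differentiable sum. *)
Lemma jet_glim_differentiable (g : nat -> V -> R[i]) (d : nat -> V -> R[i])
    (f : V -> R[i]) (x0 : V) (r c : R) : 0 < r ->
  (forall x, g 0%N x = 0) ->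
  (forall k, jet N x0 r (c * half k) (fun x => g k.+1 x - g k x) (d k)) ->
  (forall h, N h <= r -> glim (fun k => g k (x0 + h)) (f (x0 + h))) ->
  differentiable f x0.
Proof.
move=> r0 g0 J gf.
have c0 : 0 <= c by have := jet_ge0 (J 0%N); rewrite expr0 mulr1.
have halfS k : half k.+1 = half k / 2 by rewrite exprSr.
pose D k h := \sum_(j < k) d j h.
have DS k h : D k.+1 h = D k h + d k h by rewrite /D big_ord_recr.
have Dlin k (a : R[i]) x y : D k (a *: x + y) = a * D k x + D k y.
  elim: k => [|k IH]; first by rewrite /D !big_ord0 mulr0 addr0.
  by rewrite !DS IH; have [_ -> _ _] := J k; ring.
have Dcauchy h : exists l, forall k, md (D k h - l) <= 4 * (c * N h) * half k.
  apply: glim_cauchy => k; rewrite DS addrC addKr.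
  by have [_ _ + _] := J k => /(_ h); rewrite mulrAC.
(* [e] is the sum of the derivatives, and the differential of [f]. *)
pose e h := xget 0 [set l | forall k, md (D k h - l) <= 4 * (c * N h) * half k].
have eP h k : md (D k h - e h) <= 4 * (c * N h) * half k.
  by have [l Hl] := Dcauchy h; rewrite /e; case: xgetP => [y _ /(_ k)//|/(_ l)].
have De h : glim (fun k => D k h) (e h) by exists (4 * (c * N h)) => k; exact: eP.
have rem h k : N h <= r ->
    md (g k (x0 + h) - g k x0 - D k h) <= (2 * c - 2 * c * half k) * N h ^+ 2.
  move=> hr; elim: k => [|k IH].
    by rewrite /D big_ord0 !g0 !subr0 modc0 expr0 mulr1 subrr mul0r.
  have [_ _ _ /(_ h hr) H] := J k.
  rewrite DS; have -> : g k.+1 (x0 + h) - g k.+1 x0 - (D k h + d k h) =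
    (g k (x0 + h) - g k x0 - D k h) + (g k.+1 (x0 + h) - g k (x0 + h) -
      (g k.+1 x0 - g k x0) - d k h) by ring.
  apply: le_trans (modcD _ _) _; apply: le_trans (lerD IH H) _.
  by rewrite -mulrDl ler_wpM2r ?sqr_ge0// halfS; lra.
have fx0 : glim (fun k => g k x0) (f x0).
  by have := gf 0; rewrite addr0; apply; rewrite cnorm0 ltW.
apply: (@jet_differentiable _ _ N f e x0 r (md (f x0) + 4 * c)) => //.
split=> [|a x y|h|h hr].
- by rewrite lerDl mulr_ge0.
- apply: glim_unique (De _) _.
  have := glimD (glimZ a (De x)) (De y); congr glim.
  by apply/funext => k; rewrite Dlin.
- have := eP h 0%N; rewrite expr0 mulr1 /D big_ord0 sub0r modcN => H.
  by have := mulr_ge0 (modc_ge0 (f x0)) (cnorm_ge0 N h); move: H; lra.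
- apply: (@le_trans _ _ (2 * c * N h ^+ 2)); last first.
    rewrite ler_wpM2r ?sqr_ge0//.
    by have := modc_ge0 (f x0); lra.
  apply: (glim_bound (glimB (glimB (gf h hr) fx0) (De h))) => k.
  apply: le_trans (rem h k hr) _; rewrite ler_wpM2r ?sqr_ge0//.
  by have := mulr_ge0 c0 (half_exp_ge0 R k); lra.
Qed.

(** Growth by factors whose excesses over 1 are geometrically summable. *)
Lemma geom_recurrence (u : nat -> R) (a : R) : 0 <= a ->
  (forall k, 0 <= u k) -> (forall k, u k.+1 <= (1 + a * half k) * u k) ->
  forall k, u k <= expR (2 * a) * u 0%N.
Proof.
move=> a0 u0 uS k.
have H j : u j <= expR (2 * a - 2 * a * half j) * u 0%N.
  elim: j => [|j IH]; first by rewrite expr0 mulr1 subrr expR0 mul1r.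
  apply: le_trans (uS j) _.
  have ah : 0 <= a * half j by rewrite mulr_ge0// half_exp_ge0.
  apply: (@le_trans _ _ (expR (a * half j) * u j)).
    by rewrite ler_wpM2r// expR_ge1Dx.
  have -> : 2 * a - 2 * a * half j.+1 = a * half j + (2 * a - 2 * a * half j).
    by rewrite exprSr; field.
  by rewrite expRD -mulrA ler_wpM2l// expR_ge0.
apply: le_trans (H k) _; rewrite ler_wpM2r// ler_expR gerBl.
by rewrite !mulr_ge0// half_exp_ge0.
Qed.

End LimitOfJets.

Section Interpolation.
Variables (R : realType) (n : nat) (N : cnorm R n).
Local Notation V := 'rV[R[i]]_n.
Local Notation md z := (modc z : R).
Local Notation half k := ((2^-1 : R) ^+ k).

Section Iteration.
Variables (l : nat -> V -> R[i]) (m : nat -> nat).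
Hypothesis l_linear :
  forall k (a : R[i]) x y, l k (a *: x + y) = a * l k x + l k y.
Hypothesis l_le : forall k x, modc (l k x) <= N x.
Hypothesis m_gt0 : forall k, (0 < m k)%N.
Hypothesis m_large : forall k, 6 / harm R (m k) <= half k.

Local Notation pk k x := (peak (m k) (l k x)).

(** The interpolating functions: the [k]-th step replaces the current value by
    [w k] where the [k]-th peak function is close to 1, and hardly changes it
    where that function is close to 0. *)
Fixpoint interp (w : nat -> R[i]) k (x : V) : R[i] :=
  if k is j.+1 then interp w j x + pk j x * (w j - interp w j x) else 0.

Lemma interp_linear (a : R[i]) w w' k x :
  interp (fun j => a * w j + w' j) k x = a * interp w k x + interp w' k x.
Proof. by elim: k => [|k IH] /=; rewrite ?IH; ring. Qed.

Lemma harm_inv_le k : (harm R (m k))^-1 <= half k.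
Proof.
apply: le_trans (m_large k); rewrite ler_peMl ?invr_ge0 ?harm_ge0//.
by rewrite ler1n.
Qed.

Lemma interp_le (w : nat -> R[i]) (W : R) k x : (forall j, modc (w j) <= W) -> N x <= 1 ->
  modc (interp w k x) <= expR 2 * W.
Proof.
move=> wW Nx; have W0 : 0 <= W by apply: le_trans (wW 0%N); exact: modc_ge0.
(* [u k] is the product of [W] and the factors [1 + half j], [j < k]. *)
pose u := fix u k := if k is j.+1 then (1 + half j) * u j else W.
have u_geW k' : 0 <= W <= u k'.
  elim: k' => [|j /andP[_ IH]]; first by rewrite W0 lexx.
  by rewrite W0 /= (le_trans IH)// ler_peMl ?(le_trans W0)// lerDl half_exp_ge0.
have u_ge0 k' : 0 <= u k' by have /andP[? ?] := u_geW k'; lra.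
apply: (@le_trans _ _ (u k)); last first.
  rewrite -[X in expR X]mulr1; apply: (geom_recurrence ler01 u_ge0) => j.
  by rewrite mul1r.
elim: k => [|j IH]; first by rewrite modc0.
have zl : modc (l j x) <= 1 := le_trans (l_le j x) Nx.
have -> : interp w j.+1 x = (1 - pk j x) * interp w j x + pk j x * w j.
  by rewrite /=; ring.
apply: le_trans (modcD _ _) _; rewrite modcM (modcM (pk j x)).
apply: (@le_trans _ _ ((md (1 - pk j x) + md (pk j x)) * u j)).
  rewrite mulrDl; apply: lerD; apply: ler_wpM2l; rewrite ?modc_ge0//.
  by apply: le_trans (wW j) _; have /andP[] := u_geW j.
apply: ler_wpM2r => //; apply: le_trans (peak_segment zl (m_gt0 j)) _.
by rewrite lerD2l.
Qed.

Lemma interp_step (w : nat -> R[i]) (W : R) (s : R) k x :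
  (forall j, modc (w j) <= W) -> s < 1 -> N x <= s ->
  modc (interp w k.+1 x - interp w k x)
    <= (harm R (m k))^-1 / (1 - s) * ((1 + expR 2) * W).
Proof.
move=> wW s1 Nx; have s0 : 0 <= s := le_trans (cnorm_ge0 _ _) Nx.
rewrite /= addrC addKr modcM; apply: ler_pM; rewrite ?modc_ge0//.
  by apply: peak_small; rewrite ?s0//; apply: le_trans Nx.
apply: le_trans (modcD _ _) _; rewrite modcN mulrDl mul1r lerD//.
by apply: interp_le => //; apply: le_trans Nx _; exact: ltW.
Qed.

Lemma interp_glim (w : nat -> R[i]) (W : R) x :
  (forall j, modc (w j) <= W) -> N x < 1 ->
  exists a, glim (fun k => interp w k x) a.
Proof.
move=> wW Nx; have W0 : 0 <= W by apply: le_trans (wW 0%N); exact: modc_ge0.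
have Nx' : 0 < 1 - N x by rewrite subr_gt0.
have [k|a Ha] := @glim_cauchy _ (fun k => interp w k x)
    ((1 - N x)^-1 * ((1 + expR 2) * W)); last first.
  by exists a, (4 * ((1 - N x)^-1 * ((1 + expR 2) * W))).
apply: le_trans (interp_step k wW Nx (lexx _)) _.
rewrite [leRHS]mulrC -mulrA; apply: ler_wpM2r.
  by rewrite mulr_ge0 ?invr_ge0 ?(ltW Nx')// mulr_ge0// addr_ge0// expR_ge0.
exact: harm_inv_le.
Qed.

(** The limit of the iteration; it is 0 by convention where the iterates do not
    converge geometrically. *)
Definition interp_lim w x : R[i] := xget 0 [set a | glim (fun k => interp w k x) a].

Lemma interp_limP (w : nat -> R[i]) (W : R) x :
  (forall j, modc (w j) <= W) -> N x < 1 ->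
  glim (fun k => interp w k x) (interp_lim w x).
Proof.
move=> wW /(interp_glim wW)[a Ha]; rewrite /interp_lim.
by case: xgetP => [//|/(_ a)].
Qed.

(** The increments of the iteration have geometrically small jets at every
    point of the ball. *)
Lemma interp_lim_differentiable (w : nat -> R[i]) (W : R) x0 :
  (forall j, modc (w j) <= W) -> N x0 < 1 -> differentiable (interp_lim w) x0.
Proof.
move=> wW Nx; have W0 : 0 <= W by apply: le_trans (wW 0%N); exact: modc_ge0.
have N0 := cnorm_ge0 N x0.
pose r : R := (1 - N x0) / 2; pose s : R := (1 + N x0) / 2.
have r0 : 0 < r by rewrite /r divr_gt0// subr_gt0.
have r1 : r <= 1 by rewrite /r; lra.
have sP : 2^-1 <= s < 1 by rewrite /s; apply/andP; split; lra.
have Nrs : N x0 + r <= s by rewrite /r /s; lra.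
pose b := 2 / (1 - s) ^+ 2.
have b0 : 0 <= b by rewrite divr_ge0// sqr_ge0.
have peakJ k : jet N x0 r (b * half k) (fun x => pk k x)
    (fun h => dpeak (m k) (l k x0) * l k h).
  apply: jet_le (jet_peak (m k) (l_linear k) (l_le k) sP Nrs (ltW r0)).
  by rewrite mulrC ler_wpM2l// harm_inv_le.
clearbody b.
(* [A k] bounds the jet of the [k]-th iterate. *)
pose A := fix A k := if k is j.+1 then A j + 6 * (b * half j * (W + A j)) else 0.
have A_ge0 k : 0 <= A k.
  elim: k => [//|k IH] /=; rewrite addr_ge0// mulr_ge0// mulr_ge0 ?addr_ge0//.
  by rewrite mulr_ge0// half_exp_ge0.
have A_le k : W + A k <= expR (2 * (6 * b)) * W.
  have := @geom_recurrence _ (fun k => W + A k) (6 * b); rewrite /= addr0.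
  apply; first by rewrite mulr_ge0.
    by move=> j; rewrite addr_ge0.
  by move=> j; rewrite le_eqVlt; apply/orP; left; apply/eqP; ring.
have stepJ k dk : jet N x0 r (A k) (interp w k) dk ->
  jet N x0 r (6 * (b * half k * (W + A k)))
    (fun x => pk k x * (w k - interp w k x))
    (fun h => pk k x0 * (- dk h)
       + (w k - interp w k x0) * (dpeak (m k) (l k x0) * l k h)).
  move=> J; apply: (jetM r1 (peakJ k)).
  case: J => [g1 g2 g3 g4]; split=> [|a x y|h|h hr].
  - by apply: le_trans (modcD _ _) _; rewrite modcN lerD.
  - by rewrite g2; ring.
  - rewrite modcN; apply: le_trans (g3 h) _; rewrite ler_wpM2r ?cnorm_ge0//.
    by rewrite lerDr.
  - have -> : w k - interp w k (x0 + h) - (w k - interp w k x0) - - dk h =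
      - (interp w k (x0 + h) - interp w k x0 - dk h) by ring.
    rewrite modcN; apply: le_trans (g4 h hr) _; rewrite ler_wpM2r ?sqr_ge0//.
    by rewrite lerDr.
have interpJ k : exists dk, jet N x0 r (A k) (interp w k) dk.
  elim: k => [|k [dk J]].
    by exists (fun=> 0); have := jet_cst N x0 r 0; rewrite modc0.
  by have := jetD J (stepJ k dk J); eexists; eassumption.
have [dd ddJ] := choice interpJ.
apply: (@jet_glim_differentiable _ _ N (interp w) _ _ x0 r
  (6 * b * (expR (2 * (6 * b)) * W)) r0) => //.
  move=> k; have J := stepJ k _ (ddJ k).
  have -> : (fun x => interp w k.+1 x - interp w k x) =
      (fun x => pk k x * (w k - interp w k x)).
    by apply/funext => x /=; rewrite addrC addKr.
  apply: jet_le J.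
  rewrite -!mulrA; apply: ler_wpM2l => //; apply: ler_wpM2l => //.
  rewrite [leLHS]mulrC [leRHS]mulrA; apply: ler_wpM2r; last exact: A_le.
  exact: half_exp_ge0.
move=> h hr; apply: (interp_limP wW).
by apply: le_lt_trans (cnormD _ _ _) _; have /andP[_ s1] := sP; lra.
Qed.

Lemma interp_lim_le (w : nat -> R[i]) (W : R) x :
  (forall j, modc (w j) <= W) -> N x < 1 -> modc (interp_lim w x) <= expR 2 * W.
Proof.
move=> wW Nx; apply: (glim_bound (interp_limP wW Nx)) => k.
by apply: interp_le => //; exact: ltW.
Qed.

Lemma interp_lim_linear (a : R[i]) w w' (W W' : R) x :
  (forall j, modc (w j) <= W) -> (forall j, modc (w' j) <= W') -> N x < 1 ->
  interp_lim (fun j => a * w j + w' j) x = a * interp_lim w x + interp_lim w' x.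
Proof.
move=> wW wW' Nx.
have bd j : modc (a * w j + w' j) <= md a * W + W'.
  by apply: le_trans (modcD _ _) _; rewrite modcM lerD// ler_wpM2l ?modc_ge0.
apply: glim_unique (interp_limP bd Nx) _.
have := glimD (glimZ a (interp_limP wW Nx)) (interp_limP wW' Nx); congr glim.
by apply/funext => k; rewrite interp_linear.
Qed.

(** At a point where the [j]-th peak function is almost 1 and the later ones
    are small, the limit is close to [w j]. *)
Lemma interp_lim_near (w : nat -> R[i]) (W : R) (s : R) j x :
  (forall j, modc (w j) <= W) -> s < 1 -> N x <= s ->
  modc (1 - pk j x) <= half j ->
  (forall k, (j < k)%N -> (harm R (m k))^-1 <= half k * (1 - s)) ->
  modc (interp_lim w x - w j) <= 2 * ((1 + expR 2) * W) * half j.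
Proof.
move=> wW s1 Nx pj mk; have W0 : 0 <= W by apply: le_trans (wW 0%N); exact: modc_ge0.
have Nx1 : N x < 1 := le_lt_trans Nx s1.
have s1' : 0 < 1 - s by rewrite subr_gt0.
pose Q := (1 + expR 2) * W.
have Q0 : 0 <= Q by rewrite mulr_ge0// addr_ge0// expR_ge0.
have H k : md (interp w (k + j.+1)%N x - w j) <= Q * (2 * half j - half (k + j)%N).
  elim: k => [|k IH].
    have -> : interp w (0 + j.+1) x - w j = (1 - pk j x) * (interp w j x - w j).
      by rewrite /=; ring.
    rewrite modcM mulrC add0n; apply: (@le_trans _ _ (Q * half j)); last first.
      by apply: ler_wpM2l => //; lra.
    apply: ler_pM; rewrite ?modc_ge0//.
    apply: le_trans (modcD _ _) _; rewrite modcN /Q addrC mulrDl mul1r lerD//.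
    by apply: interp_le => //; exact: ltW.
  rewrite -(subrKA (interp w (k + j.+1)%N x)); apply: le_trans (modcD _ _) _.
  rewrite !addSn; apply: le_trans (lerD (interp_step _ wW s1 Nx) IH) _.
  have kj : (j < k + j.+1)%N by rewrite addnS ltnS leq_addl.
  have : (harm R (m (k + j.+1)))^-1 / (1 - s) * Q <= half (k + j.+1) * Q.
    by apply: ler_wpM2r => //; rewrite ler_pdivrMr// mk.
  rewrite -/Q addnS !exprS => H1; apply: le_trans (lerD H1 (lexx _)) _.
  move: (half (k + j)%N) (half j) => p q.
  by rewrite le_eqVlt; apply/orP; left; apply/eqP; field.
apply: (glim_bound (u := fun k => interp w (k + j.+1)%N x - w j)).
  exact: glimB (glim_shift j.+1 (interp_limP wW Nx1)) (glim_cst (w j)).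
move=> k; apply: le_trans (H k) _; rewrite -/Q mulrBr.
have -> : Q * (2 * half j) = 2 * Q * half j by ring.
rewrite gerBl.
by rewrite mulr_ge0 ?half_exp_ge0.
Qed.

End Iteration.

End Interpolation.

(** * Asymptotic interpolation by bounded holomorphic functions *)

Section InterpolationTheorem.
Variables (R : realType) (n : nat) (N : cnorm R n).
Local Notation V := 'rV[R[i]]_n.
Local Notation md z := (modc z : R).
Local Notation half k := ((2^-1 : R) ^+ k).

(** [w] is bounded by [W]. *)
Definition bounded_seq_by (w : nat -> R[i]) (W : R) := forall j, modc (w j) <= W.

(** One step of the choice of parameters: [s] bounds the radii chosen so far. *)
Lemma peak_choice (T : set R) (k : nat) (s : R) :
  (forall s : R, s < 1 -> exists t, T t /\ s < t < 1) -> s < 1 ->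
  exists mt : nat * R, [/\ (0 < mt.1)%N, 6 / harm R mt.1 <= half k,
    (harm R mt.1)^-1 <= half k * (1 - s), T mt.2 &
    [/\ s < mt.2, 1 - half k < mt.2 < 1 & modc (1 - peak mt.1 (mt.2)%:C) <= half k]].
Proof.
move=> Tacc s1; have h0 := half_exp_gt0 R k; have s1' : 0 < 1 - s by rewrite subr_gt0.
have hs0 : 0 < half k * (1 - s) by rewrite mulr_gt0.
have [m m0 mH] := harm_unbounded (Num.max (6 / half k) (half k * (1 - s))^-1).
have Hm0 := harm_gt0 R m0.
have [u u1 Hu] := peak_at1 m0 h0.
have [t [Tt /andP[st t1]]] := Tacc (Num.max (Num.max u s) (1 - half k))
  ltac:(by rewrite !gt_max u1 s1 gtrDl oppr_lt0).
move: st; rewrite !gt_max => /andP[/andP[ut st] kt].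
have hle1 := half_exp_le1 R k.
exists (m, t); split => //=.
- by rewrite ler_pdivrMr// -ler_pdivrMl// mulrC (le_trans _ mH)// le_max lexx.
- rewrite -[leRHS]invrK lef_pV2 ?posrE ?invr_gt0// (le_trans _ mH)//.
  by rewrite le_max lexx orbT.
- split=> //; first by rewrite kt.
  by apply: Hu; rewrite ?ut// (le_trans _ (ltW kt))// subr_ge0.
Qed.

Lemma hinf_of_differentiable (f : V -> R[i]) (C : R) :
  (forall x, N x < 1 -> differentiable f x) ->
  (forall x, N x < 1 -> modc (f x) <= C) ->
  exists F : Hinf N, forall x : unit_ball N, F x = f (val x).
Proof.
move=> df fC; pose g (x : unit_ball N) := f (val x).
have gP : g \in hinf_pred (N := N).
  apply/asboolP; split; last first.
    by exists C => x; apply: fC; have := set_valP x.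
  move=> z Bz; apply: near_eq_differentiable (df z Bz).
  apply: filterS (open_nbhs_nbhs (conj (@open_unit_ball _ _ N) Bz)) => y By.
  by rewrite (valL0_in _ (mem_set By)).
by exists (MkHinf gP).
Qed.

(** Points approaching the sphere fast enough along the given rays are
    asymptotically interpolating, by a bounded linear operator. The radii may
    be chosen in prescribed sets [T j] accumulating at 1. *)
Theorem asymptotic_interpolation (z : nat -> V) (T : nat -> set R) :
  (forall j, N (z j) = 1) ->
  (forall j (s : R), s < 1 -> exists t, T j t /\ s < t < 1) ->
  exists (t : nat -> R) (C : R) (E : (nat -> R[i]) -> Hinf N), [/\
    forall j, T j (t j) /\ 1 - half j < t j < 1,
    forall w W, bounded_seq_by w W -> forall x, modc (E w x) <= C * W,
    forall w W, bounded_seq_by w W ->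
      forall j, modc ('valL_0 (E w) ((t j)%:C *: z j) - w j) <= C * W * half j &
    forall (a : R[i]) w w' W W', bounded_seq_by w W -> bounded_seq_by w' W' ->
      E (fun j => a * w j + w' j) = a *: E w + E w'].
Proof.
move=> zS Tacc.
have [l Hl] := choice (fun j => norming_functional (zS j)).
have step (ks : nat * R) : exists mt : nat * R, ks.2 < 1 ->
  [/\ (0 < mt.1)%N, 6 / harm R mt.1 <= half ks.1,
    (harm R mt.1)^-1 <= half ks.1 * (1 - ks.2), T ks.1 mt.2 &
    [/\ ks.2 < mt.2, 1 - half ks.1 < mt.2 < 1 &
      modc (1 - peak mt.1 (mt.2)%:C) <= half ks.1]].
  case: ks => k s /=; have [s1|s1] := ltP s 1; last by exists (0%N, 0).
  by have [mt H] := peak_choice k (Tacc k) s1; exists mt.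
have {step}[mt Hmt] := choice step.
(* [s k] is the radius chosen at the previous step, and 0 at the start. *)
pose s := fix s k : R := if k is j.+1 then (mt (j, s j)).2 else 0.
have s1 k : s k < 1.
  by elim: k => [|k /(Hmt (k, _))[_ _ _ _ [_ /andP[]]]] //=; rewrite ltr01.
pose m k := (mt (k, s k)).1; pose t k := s k.+1.
have mt_P k := Hmt (k, s k) (s1 k).
have s_le j k : (j <= k)%N -> s j <= s k.
  have /nondecreasing_seqP : forall k, s k <= s k.+1.
    by move=> i; have [_ _ _ _ [/ltW]] := mt_P i.
  exact.
have l_lin k (a : R[i]) x y : l k (a *: x + y) = a * l k x + l k y.
  by have [+ _ _] := Hl k.
have l_le k x : modc (l k x) <= N x by have [_ + _] := Hl k.
have lz k : l k (z k) = 1 by have [_ _] := Hl k.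
have m0 k : (0 < m k)%N by have [] := mt_P k.
have mH k : 6 / harm R (m k) <= half k by have [] := mt_P k.
pose f := interp_lim l m.
have Ex w : exists F : Hinf N, forall W, bounded_seq_by w W ->
    forall x : unit_ball N, F x = f w (val x).
  have [[W wW]|nW] := boolp.pselect (exists W, bounded_seq_by w W); last first.
    by exists 0 => W wW; case: nW; exists W.
  have [|x Nx|F HF] := @hinf_of_differentiable (f w) (expR 2 * W).
  - by move=> x Nx; apply: (interp_lim_differentiable l_lin l_le m0 mH wW Nx).
  - exact: (interp_lim_le l_le m0 mH wW).
  - by exists F.
have [E EP] := choice Ex.
have t_gt k : 1 - half k < t k < 1 by have [_ _ _ _ []] := mt_P k.
have t0 k : 0 <= t k by apply: s_le 0%N k.+1 _.
exists t, (2 * (1 + expR 2)), E; split.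
- by move=> j; split; [have [] := mt_P j|].
- move=> w W wW x; rewrite (EP _ _ wW).
  have Nx : N (val x) < 1 by have := set_valP x.
  apply: le_trans (interp_lim_le l_le m0 mH wW Nx) _.
  have W0 : 0 <= W by apply: le_trans (wW 0%N); exact: modc_ge0.
  by apply: ler_wpM2r => //; have := expR_ge0 (2 : R); lra.
- move=> w W wW j.
  have Nt : N ((t j)%:C *: z j) = t j.
    by rewrite cnormZ zS mulr1 modc_real ger0_norm.
  have Bt : (t j)%:C *: z j \in unit_ball N.
    by apply/mem_set; have /andP[_] := t_gt j; rewrite -{1}Nt.
  rewrite (valL0_in _ Bt) (EP _ _ wW) /= -[2 * _ * W]mulrA.
  apply: (interp_lim_near (s := t j) l_le m0 mH wW) => //.
  - by have /andP[] := t_gt j.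
  - by rewrite Nt.
    have -> : l j ((t j)%:C *: z j) = (t j)%:C.
      have := l_lin j (t j)%:C (z j) 0; rewrite addr0 lz mulr1.
      have := l_lin j (-1) 0 0; rewrite scaler0 addr0 mulN1r addNr => ->.
      by rewrite addr0.
    by have [_ _ _ _ []] := mt_P j.
  move=> k jk; have [_ _ H _ _] := mt_P k; apply: le_trans H _.
  by apply: ler_wpM2l; rewrite ?half_exp_ge0// lerB// s_le.
- move=> a w w' W W' wW wW'; apply/val_inj/funext => x.
  have bd : bounded_seq_by (fun j => a * w j + w' j) (md a * W + W').
    move=> j; apply: le_trans (modcD _ _) _.
    by rewrite modcM lerD// ler_wpM2l ?modc_ge0.
  rewrite -[RHS]/(a * E w x + E w' x) -[LHS]/(E (fun j => a * w j + w' j) x).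
  rewrite (EP _ _ wW) (EP _ _ wW') (EP _ _ bd).
  have Nx : N (val x) < 1 by have := set_valP x.
  exact: (interp_lim_linear l_le m0 mH a wW wW' Nx).
Qed.

End InterpolationTheorem.

(** * Radial cluster sets, rational approximation and polynomial maps *)

Section ClusterSets.
Variables (R : realType) (n : nat) (N : cnorm R n).
Local Notation V := 'rV[R[i]]_n.
Local Notation md z := (modc z : R).
Local Notation half k := ((2^-1 : R) ^+ k).

Lemma rCl_approx (f : Hinf N) x (mu : R[i]) : rCl f x mu <->
  forall e : R, 0 < e -> exists t : R,
    1 - e < t < 1 /\ modc ('valL_0 f (t%:C *: x) - mu) < e.
Proof.
split=> [[t [t01 t1 fmu]] e e0|H].
  have e0' : 0 < e%:C by rewrite ltcR.
  move/cvgrPdist_lt: t1 => /(_ _ e0)[k1 _ Hk1].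
  move/cvgrPdist_lt: fmu => /(_ _ e0')[k2 _ Hk2].
  pose k := maxn k1 k2; exists (t k).
  have := Hk1 k (leq_maxl _ _); have /andP[_ tk1] := t01 k => /= Hk.
  split; first by rewrite tk1 andbT ltrBlDl -ltrBlDr (le_lt_trans (ler_norm _) Hk).
  have /= := Hk2 k (leq_maxr _ _).
  by rewrite modcE ltcR modc_sub.
have half0 k : 0 < half k := half_exp_gt0 R k.
have [t Ht] := choice (fun k => H _ (half0 k)).
have small (e : R) : 0 < e -> \forall k \near \oo, half k < e.
  move=> /(half_exp_small 1)[k Hk]; exists k => // j /= kj.
  by apply: le_lt_trans (half_exp_nincr R kj) _; rewrite -[X in X < _]mul1r.
exists t; split.
- move=> k; have [/andP[tk ->] _] := Ht k; rewrite andbT.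
  by apply: le_lt_trans tk; rewrite subr_ge0 half_exp_le1.
- apply/cvgrPdist_lt => e /small; apply: filterS => k ke.
  have [/andP[tk tk1] _] := Ht k.
  by rewrite gtr0_norm ?subr_gt0//; lra.
- apply/cvgrPdist_lt => e e0.
  have eR : e = (complex.Re e)%:C by rewrite RRe_real// realE ltW.
  have e0' : 0 < complex.Re e by move: e0; rewrite {1}eR ltcR.
  have := small _ e0'; apply: filterS => k ke.
  have [_ Hk] := Ht k.
  by rewrite modcE eR ltcR modc_sub; exact: lt_trans Hk ke.
Qed.

(** A radial cluster set of a bounded function is bounded by its norm. *)
Lemma rCl_le (f : Hinf N) x (mu : R[i]) : N x = 1 -> rCl f x mu ->
  modc mu <= hinf_norm f.
Proof.
move=> Nx /rCl_approx H; apply/ler_addgt0Pl => e e0.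
pose d := Num.min e 1; have d0 : 0 < d by rewrite lt_min e0 ltr01.
have [t [/andP[t1 t2] Ht]] := H d d0.
have t0 : 0 <= t.
  by apply: le_trans (ltW t1); rewrite subr_ge0 ge_min lexx orbT.
have Bt : t%:C *: x \in unit_ball N.
  apply/mem_set; have -> : unit_ball N (t%:C *: x) = (N (t%:C *: x) < 1) by [].
  by rewrite cnormZ Nx mulr1 modc_real ger0_norm.
move: Ht; rewrite (valL0_in _ Bt) => Ht.
rewrite -(subrK (f (SigSub Bt)) mu); apply: le_trans (modcD _ _) _.
apply: lerD; last exact: hinf_norm_ub.
rewrite modc_sub; apply: le_trans (ltW Ht) _.
by rewrite ge_min lexx.
Qed.

(** The radial cluster sets of 0 contain no disc. *)
Lemma disc_cluster_neq0 (M : set V) (f : Hinf N) : M `<=` unit_sphere N -> M !=set0 ->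
  disc_in_radial_cluster_sets M f -> f != 0.
Proof.
move=> MS [z Mz] [c [r [r0 H]]]; apply/eqP => f0.
have n0 : hinf_norm (0 : Hinf N) <= 0.
  by apply: hinf_norm_le => x; rewrite -[X in modc X]/(0 : R[i]) modc0.
have Hd (u : R[i]) : modc (u - c) < r -> u = 0.
  move=> uc; have uD : disc c r u by rewrite /disc /= modcE ltcR.
  have := rCl_le (MS z Mz) (H u uD z Mz); rewrite f0 => /le_trans/(_ n0) u0.
  by apply/modc0_eq0/eqP; rewrite eq_le u0 modc_ge0.
have c0 : c = 0 by apply: Hd; rewrite subrr modc0.
have := Hd (r / 2)%:C; rewrite c0 subr0 modc_real ger0_norm ?divr_ge0 ?ltW//.
move=> /(_ ltac:(by rewrite ltr_pdivrMr// ltr_pMr// ltr1n))/complexI/eqP.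
by rewrite mulf_eq0 invr_eq0 pnatr_eq0 orbF gt_eqF.
Qed.

End ClusterSets.

Section RationalApproximation.
Variable R : realType.
Local Notation md z := (modc z : R).

(** Complex numbers with rational real and imaginary parts. *)
Definition gauss_rat (q : rat * rat) : R[i] := (ratr q.1 +i* ratr q.2)%C.

Lemma gauss_rat_dense (z : R[i]) (e : R) : 0 < e ->
  exists q, modc (gauss_rat q - z) < e.
Proof.
move=> e0; have near (x : R) : exists q : rat, `|ratr q - x| < e / 2.
  have [q /itvP qi] := @rat_in_itvoo R (x - e / 2) (x + e / 2)
    ltac:(by rewrite ltrBlDr -addrA ltrDl -splitr).
  by exists q; rewrite ltr_distl !qi.
have [[q1 H1] [q2 H2]] := (near (complex.Re z), near (complex.Im z)).
exists (q1, q2); apply: le_lt_trans (modc_le_ReIm _) _.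
by rewrite !raddfB /= [e]splitr ltrD.
Qed.

Lemma gauss_rat_dense_ball (z : R[i]) (e r : R) : 0 < e -> modc z < r ->
  exists2 q, modc (gauss_rat q) < r & modc (gauss_rat q - z) < e.
Proof.
move=> e0 zr; have [q] := @gauss_rat_dense z (Num.min e (r - modc z))
  ltac:(by rewrite lt_min e0 subr_gt0).
rewrite lt_min => /andP[qe qr]; exists q => //.
rewrite -(subrK z (gauss_rat q)); apply: le_lt_trans (modcD _ _) _.
by rewrite -ltrBrDr.
Qed.

(** The same, restricted to the closed unit disc: points outside are replaced
    by 0. *)
Definition unit_gauss_rat q : R[i] :=
  if modc (gauss_rat q) <= 1 then gauss_rat q else 0.

Lemma unit_gauss_rat_le1 q : modc (unit_gauss_rat q) <= 1.
Proof. by rewrite /unit_gauss_rat; case: ifP => // _; rewrite modc0. Qed.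

Lemma unit_gauss_rat_dense (z : R[i]) (e : R) : 0 < e -> modc z < 1 ->
  exists q, modc (unit_gauss_rat q - z) < e.
Proof.
move=> e0 /(gauss_rat_dense_ball e0)[q q1 qz]; exists q.
by rewrite /unit_gauss_rat ltW.
Qed.

End RationalApproximation.

Lemma pickle_unbounded (X : countType) (x : X) (L : nat) :
  exists k : nat, (L <= pickle (x, k))%N.
Proof.
apply: contrapT => /forallNP H.
have H' (k : nat) : (pickle (x, k) < L)%N by rewrite ltnNge; apply/negP/H.
pose g (k : 'I_L.+1) : 'I_L := Ordinal (H' k).
have g_inj : injective g.
  move=> i j /(congr1 val) /= /(pcan_inj pickleK)[/val_inj].
  exact.
by have := leq_card g g_inj; rewrite !card_ord ltnn.
Qed.

Section Polynomials.
Variable R : realType.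
Local Notation md z := (modc z : R).

(** A value close to that of a non-constant polynomial at 0 is taken close to
    0: the product of the moduli of the roots of [p - mu] is small. *)
Lemma poly_open_at0 (p : {poly R[i]}) (eta : R) : (1 < size p)%N -> 0 < eta ->
  exists2 r : R, 0 < r & forall mu, modc (mu - p.[0]) < r ->
    exists2 s, modc s < eta & p.[s] = mu.
Proof.
move=> sp eta0; have p0 : p != 0 by rewrite -size_poly_eq0 -lt0n ltnW.
have lc0 : 0 < md (lead_coef p).
  rewrite lt_neqAle modc_ge0 andbT eq_sym; apply: contra p0 => /eqP/modc0_eq0/eqP.
  by rewrite lead_coef_eq0.
exists (md (lead_coef p) * eta ^+ (size p).-1).
  by rewrite mulr_gt0// exprn_gt0.
move=> mu Hmu; pose q := p - mu%:P.
have sq : size q = size p.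
  by rewrite /q size_polyDl// size_polyN (leq_ltn_trans (size_polyC_leq1 _)).
have lq : lead_coef q = lead_coef p.
  by rewrite /q lead_coefDl// size_polyN (leq_ltn_trans (size_polyC_leq1 _)).
have [rs qE] := closed_field_poly_normal q.
have srs : size rs = (size p).-1.
  rewrite -sq qE size_scale ?size_prod_XsubC//.
  by rewrite lead_coef_eq0 -size_poly_eq0 sq size_poly_eq0.
have [s srs' s_small] : exists2 s, s \in rs & modc s < eta.
  apply: contrapT => H.
  have big s : s \in rs -> eta <= modc s.
    by move=> ss; rewrite leNgt; apply/negP => ?; apply: H; exists s.
  move: Hmu; apply/negP; rewrite -leNgt modc_sub.
  have -> : p.[0] - mu = q.[0] by rewrite /q hornerD hornerN hornerC.
  rewrite qE hornerZ lq modcM; apply: ler_wpM2l; first exact: modc_ge0.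
  rewrite -srs {srs qE H}; elim: rs big => [|s rs IH] big.
    by rewrite big_nil hornerC modc1 expr0.
  rewrite big_cons hornerM modcM hornerXsubC sub0r modcN exprS.
  apply: ler_pM; rewrite ?exprn_ge0 ?(ltW eta0) ?big ?mem_head//.
  by apply: IH => t ts; apply: big; rewrite in_cons ts orbT.
exists s => //; apply/eqP; rewrite -subr_eq0.
have -> : p.[s] - mu = q.[s] by rewrite /q hornerD hornerN hornerC.
rewrite qE hornerZ; apply/eqP; rewrite (_ : _.[s] = 0) ?mulr0//.
by apply/eqP; rewrite -/(root _ _) root_prod_XsubC.
Qed.

Local Notation mp m := (mpoly.mpoly m R[i]).

Lemma horner_mmap m (Q : mp m) (q : 'I_m -> {poly R[i]}) s :
  (mpoly.mmap polyC q Q).[s] = mpoly.meval (fun i => (q i).[s]) Q.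
Proof.
rewrite /mpoly.meval /mpoly.mmap horner_sum; apply: eq_bigr => k _.
rewrite hornerM hornerC; congr (_ * _).
rewrite /mpoly.mmap1 horner_prod; apply: eq_bigr => i _.
by rewrite horner_exp.
Qed.

(** Along the segment from [a] to [b] a polynomial that takes different values
    at [a] and at [b] covers a disc centred at its value at [a]. *)
Lemma mpoly_open_along m (Q : mp m) (a b : 'I_m -> R[i]) (eta : R) : 0 < eta ->
  mpoly.meval b Q != mpoly.meval a Q ->
  exists2 r : R, 0 < r & forall mu, modc (mu - mpoly.meval a Q) < r ->
    exists2 s, modc s < eta & mpoly.meval (fun i => a i + s * (b i - a i)) Q = mu.
Proof.
move=> eta0 ab.
pose p := mpoly.mmap polyC (fun i => (a i)%:P + (b i - a i) *: 'X) Q.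
have pE s : p.[s] = mpoly.meval (fun i => a i + s * (b i - a i)) Q.
  rewrite horner_mmap; congr mpoly.meval; apply/funext => i.
  by rewrite hornerD hornerC hornerZ hornerX [s * _]mulrC.
have p0 : p.[0] = mpoly.meval a Q.
  by rewrite pE; congr mpoly.meval; apply/funext => i; rewrite mul0r addr0.
have p1 : p.[1] = mpoly.meval b Q.
  by rewrite pE; congr mpoly.meval; apply/funext => i; rewrite mul1r addrC subrK.
have sp : (1 < size p)%N.
  rewrite ltnNge; apply: contra ab => /size1_polyC pc.
  by rewrite -p0 -p1 pc !hornerC.
have [r r0 Hr] := poly_open_at0 sp eta0.
exists r => // mu; rewrite -p0 => /Hr[s ss ps]; exists s => //.
by rewrite -pE.
Qed.

(** Continuity at [v] of a function of finitely many complex variables. *)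
Definition eps_continuous m (F : ('I_m -> R[i]) -> R[i]) (v : 'I_m -> R[i]) :=
  forall e : R, 0 < e -> exists2 d : R, 0 < d &
    forall u, (forall i, modc (u i - v i) < d) -> modc (F u - F v) < e.

Lemma eps_continuousD m (F G : ('I_m -> R[i]) -> R[i]) v :
  eps_continuous F v -> eps_continuous G v -> eps_continuous (fun u => F u + G u) v.
Proof.
move=> Fv Gv e e0; have e2 : 0 < e / 2 by rewrite divr_gt0.
have [[d d0 Hd] [d' d'0 Hd']] := (Fv _ e2, Gv _ e2).
exists (Num.min d d'); first by rewrite lt_min d0.
move=> u Hu; rewrite opprD addrACA; apply: le_lt_trans (modcD _ _) _.
rewrite [e]splitr ltrD// ?Hd ?Hd'// => i; have := Hu i; rewrite lt_min.
  by case/andP.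
by case/andP.
Qed.

Lemma eps_continuousM m (F G : ('I_m -> R[i]) -> R[i]) v :
  eps_continuous F v -> eps_continuous G v -> eps_continuous (fun u => F u * G u) v.
Proof.
move=> Fv Gv e e0; pose K : R := modc (F v) + modc (G v) + 1.
have K1 : 1 <= K by rewrite lerDr addr_ge0 ?modc_ge0.
pose e' := Num.min 1 (e / (2 * K)).
have e'0 : 0 < e' by rewrite lt_min ltr01 divr_gt0// mulr_gt0// (lt_le_trans _ K1).
have [[d d0 Hd] [d' d'0 Hd']] := (Fv _ e'0, Gv _ e'0).
exists (Num.min d d'); first by rewrite lt_min d0.
move=> u Hu.
have a1 : modc (F u - F v) < e'.
  by apply: Hd => i; have := Hu i; rewrite lt_min => /andP[].
have a2 : modc (G u - G v) < e'.
  by apply: Hd' => i; have := Hu i; rewrite lt_min => /andP[].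
have -> : F u * G u - F v * G v =
  (F u - F v) * (G u - G v) + (F u - F v) * G v + F v * (G u - G v) by ring.
have e'1 : e' <= 1 by rewrite /e' ge_min lexx.
have e'e : e' * (2 * K) <= e.
  by rewrite -ler_pdivlMr ?ge_min ?lexx ?orbT// mulr_gt0// (lt_le_trans _ K1).
apply: le_lt_trans (modcD _ _) _.
apply: le_lt_trans (lerD (modcD _ _) (lexx _)) _; rewrite !modcM.
have b1 : md (F u - F v) * md (G u - G v) <= e' * 1.
  by apply: ler_pM; rewrite ?modc_ge0 ?(ltW a1)//; apply: le_trans (ltW a2) _.
have b2 : md (F u - F v) * md (G v) <= e' * md (G v).
  by apply: ler_wpM2r; rewrite ?modc_ge0 ?(ltW a1).
have b3 : md (F v) * md (G u - G v) <= md (F v) * e'.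
  by apply: ler_wpM2l; rewrite ?modc_ge0 ?(ltW a2).
apply: le_lt_trans (lerD (lerD b1 b2) b3) _.
apply: lt_le_trans e'e; have : 0 < e' * K by rewrite mulr_gt0// (lt_le_trans _ K1).
by rewrite /K; lra.
Qed.

Lemma meval_continuous m (Q : mp m) v : eps_continuous (fun u => mpoly.meval u Q) v.
Proof.
have cst c : eps_continuous (fun=> c) v.
  by move=> e e0; exists 1 => // u _; rewrite subrr modc0.
rewrite /mpoly.meval /mpoly.mmap; elim: (mpoly.msupp Q) => [|k s IH].
  by under eq_fun do rewrite big_nil; exact: cst.
under eq_fun do rewrite big_cons; apply: eps_continuousD => //.
apply: eps_continuousM; first exact: cst.
rewrite /mpoly.mmap1; elim: (index_enum _) => [|i r IHr].
  by under eq_fun do rewrite big_nil; exact: cst.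
under eq_fun do rewrite big_cons; apply: eps_continuousM => //.
elim: (k i : nat) => [|j IHj]; first exact: cst.
under eq_fun do rewrite exprS; apply: eps_continuousM => //.
by move=> e e0; exists e.
Qed.

(** Uniqueness of the digits in base [d]. *)
Lemma base_expansion_inj d k (f g : nat -> nat) :
  (forall i, (f i < d)%N) -> (forall i, (g i < d)%N) ->
  (\sum_(i < k) f i * d ^ i = \sum_(i < k) g i * d ^ i)%N ->
  forall i, (i < k)%N -> f i = g i.
Proof.
elim: k f g => [//|k IH] f g fd gd.
have shift (u : nat -> nat) : (\sum_(i < k.+1) u i * d ^ i =
    (\sum_(i < k) u i.+1 * d ^ i) * d + u 0)%N.
  rewrite big_ord_recl expn0 muln1 addnC; congr addn.
  by rewrite big_distrl; apply: eq_bigr => i _; rewrite /= /bump add1n expnSr mulnA.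
have d0 : (0 < d)%N := leq_ltn_trans (leq0n _) (fd 0%N).
rewrite !shift => E.
have E0 : f 0%N = g 0%N.
  by have := congr1 (modn^~ d) E; rewrite /= !modnMDl !modn_small.
have H : (\sum_(i < k) f i.+1 * d ^ i = \sum_(i < k) g i.+1 * d ^ i)%N.
  by have := congr1 (divn^~ d) E; rewrite /= !divnMDl// !divn_small// !addn0.
case=> [//|i]; rewrite ltnS; apply: (IH (f \o S) (g \o S)) => // j.
  exact: fd.
exact: gd.
Qed.

(** Kronecker substitution: powers of one variable whose exponents are powers
    of a large base separate the monomials. *)
Lemma mpoly_nonvanishing m (Q : mp m) : Q != 0 -> exists v, mpoly.meval v Q != 0.
Proof.
move=> Q0; pose d := mpoly.msize Q.
pose e (k : mpoly.multinom m) : nat := (\sum_(i < m) k i * d ^ i)%N.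
pose p := mpoly.mmap polyC (fun i : 'I_m => 'X^(d ^ i)) Q.
have pE : p = \sum_(k <- mpoly.msupp Q) (mpoly.mcoeff k Q) *: 'X^(e k).
  rewrite /p /mpoly.mmap; apply: eq_bigr => k _; rewrite -mul_polyC; congr (_ * _).
  rewrite /mpoly.mmap1 /e; elim: (index_enum _) => [|i r IH].
    by rewrite !big_nil expr0.
  by rewrite !big_cons IH exprD mulnC exprM.
have e_inj k k' : k \in mpoly.msupp Q -> k' \in mpoly.msupp Q -> e k = e k' -> k = k'.
  have lt l : l \in mpoly.msupp Q -> forall i, (l i < d)%N.
    move=> lQ i; apply: leq_ltn_trans (mpoly.msize_mdeg_lt lQ).
    by rewrite mpoly.mdegE (bigD1 i)//= leq_addr.
  move=> kQ k'Q E; apply/mpoly.mnmP => i.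
  have d0 : (0 < d)%N := leq_ltn_trans (leq0n _) (lt k kQ i).
  pose ext (l : mpoly.multinom m) j := if insub j is Some i then l i else 0%N.
  have extE l (j : 'I_m) : ext l j = l j by rewrite /ext valK.
  rewrite -[LHS]extE -[RHS]extE; apply: (@base_expansion_inj d m) => //.
  - by move=> j; rewrite /ext; case: insub => // j'; exact: lt.
  - by move=> j; rewrite /ext; case: insub => // j'; exact: lt.
  - have sE l : (\sum_(i < m) ext l i * d ^ i = e l)%N.
      by apply: eq_bigr => j _; rewrite extE.
    by rewrite !sE.
have [k kQ] : exists k, k \in mpoly.msupp Q.
  have := Q0; rewrite -mpoly.msupp_eq0; case: (mpoly.msupp Q : seq _) => // k s _.
  by exists k; rewrite mem_head.
have p0 : p != 0.
  apply/eqP => /(congr1 (fun q : {poly _} => q`_(e k))); rewrite coef0 pE coef_sum.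
  rewrite (bigD1_seq k)//= ?mpoly.msupp_uniq// big_seq_cond big1 => [|k' /andP[k'Q kk']].
    rewrite coefZ coefXn eqxx mulr1 addr0 => /eqP; apply/negP.
    by rewrite -mpoly.mcoeff_msupp.
  rewrite coefZ coefXn; case: eqP => [E|_]; last by rewrite mulr0.
  by rewrite (e_inj _ _ kQ k'Q E) eqxx in kk'.
have [s ps] : exists s, p.[s] != 0.
  apply: contrapT => /forallNP H.
  pose rs : seq R[i] := [seq j%:R | j <- iota 0 (size p)].
  have := @max_poly_roots _ p rs p0; rewrite size_map size_iota ltnn => F.
  suff: false by []; apply: F.
    by apply/allP => x _; have /negP := H x; rewrite negbK.
  rewrite map_inj_uniq ?iota_uniq// => i j /eqP; rewrite eqr_nat => /eqP//.
exists (fun i => s ^+ (d ^ i)); move: ps; rewrite horner_mmap.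
by under eq_fun do rewrite hornerXn.
Qed.

Lemma meval0 m (Q : mp m) : mpoly.meval (fun=> 0) Q = constant_term Q.
Proof.
rewrite /constant_term /mpoly.meval /mpoly.mmap.
have z k : k != @mpoly.mnm0 m -> mpoly.mmap1 (fun=> 0 : R[i]) k = 0.
  move=> k0; have [i ki] : exists i, k i != 0%N.
    apply: contrapT => /forallNP H; move/eqP: k0; apply; apply/mpoly.mnmP => i.
    by rewrite mpoly.mnm0E; apply/eqP; have /negP := H i; rewrite negbK.
  by rewrite /mpoly.mmap1 (bigD1 i)//= expr0n (negbTE ki) mul0r.
have [H|H] := boolP (@mpoly.mnm0 m \in mpoly.msupp Q).
  rewrite (bigD1_seq _ H) ?mpoly.msupp_uniq//= mpoly.mmap11 mulr1.
  by rewrite big1 ?addr0// => k k0; rewrite z ?mulr0.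
rewrite big_seq_cond big1; first by apply/esym/eqP; rewrite mpoly.mcoeff_eq0.
move=> k; rewrite andbT => kQ; rewrite z ?mulr0//.
by apply: contraNneq H => <-.
Qed.

End Polynomials.

(** * Jointly dense families and the algebras they generate *)

Section PolynomialValues.
Variables (R : realType) (n : nat) (N : cnorm R n).
Local Notation V := 'rV[R[i]]_n.
Local Notation md z := (modc z : R).

Lemma hinf_sum_apply (I : Type) (s : seq I) (F : I -> Hinf N) x :
  (\sum_(i <- s) F i) x = \sum_(i <- s) F i x.
Proof.
by elim: s => [|i s IH]; rewrite ?big_nil// !big_cons -IH.
Qed.

Lemma hinf_prod_apply (I : Type) (s : seq I) (F : I -> Hinf N) x :
  (\prod_(i <- s) F i) x = \prod_(i <- s) F i x.
Proof.
by elim: s => [|i s IH]; rewrite ?big_nil// !big_cons -IH.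
Qed.

Lemma hinf_exp_apply (f : Hinf N) k x : (f ^+ k) x = f x ^+ k.
Proof. by elim: k => [//|k IH]; rewrite !exprS -IH. Qed.

Lemma poly_value_apply m (Q : mpoly.mpoly m R[i]) (g : 'I_m -> Hinf N) x :
  (poly_value Q g : Hinf N) x = mpoly.meval (fun i => g i x) Q.
Proof.
rewrite /poly_value /mpoly.meval /mpoly.mmap hinf_sum_apply.
apply: eq_bigr => k _.
rewrite -[LHS]/((mpoly.mcoeff k Q * 1) * (mpoly.mmap1 g k : Hinf N) x) mulr1.
congr (_ * _); rewrite /mpoly.mmap1 hinf_prod_apply; apply: eq_bigr => i _.
exact: hinf_exp_apply.
Qed.

Lemma poly_value_valL0 m (Q : mpoly.mpoly m R[i]) (g : 'I_m -> Hinf N) z :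
  N z < 1 -> 'valL_0 (poly_value Q g : Hinf N) z =
    mpoly.meval (fun i => 'valL_0 (g i) z) Q.
Proof.
move=> Nz; have Bz : z \in unit_ball N by apply/mem_set.
rewrite (valL0_in _ Bz) poly_value_apply.
by apply: mpoly.meval_eq => i; rewrite (valL0_in _ Bz).
Qed.

End PolynomialValues.

Section JointlyDense.
Variables (R : realType) (n : nat) (N : cnorm R n).
Local Notation V := 'rV[R[i]]_n.
Local Notation md z := (modc z : R).

(** Near 1 on every ray through [M], the values of finitely many members of
    the family [h] come close to any prescribed point of the polydisc with
    centre [a] and radius [rho]. *)
Definition jointly_dense (M : set V) (I : eqType) (h : I -> Hinf N)
    (a : I -> R[i]) (rho : R) :=
  forall (s : seq I) (v : I -> R[i]), (forall i, modc (v i - a i) < rho) ->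
  forall z, M z -> forall e : R, 0 < e -> exists t : R, 1 - e < t < 1 /\
    forall i, i \in s -> modc ('valL_0 (h i) (t%:C *: z) - v i) < e.

Variables (M : set V) (I : eqType) (h : I -> Hinf N) (a : I -> R[i]) (rho : R).
Hypothesis M_sphere : M `<=` unit_sphere N.
Hypothesis M_neq0 : M !=set0.
Hypothesis rho0 : 0 < rho.
Hypothesis h_dense : jointly_dense M h a rho.

(** A polynomial expression in the members of a jointly dense family either is
    constant as a function of the variables, or contains a disc in its radial
    cluster sets. *)
Lemma jointly_dense_poly m (Q : mpoly.mpoly m R[i]) (idx : 'I_m -> I) (b : I -> R[i]) :
  mpoly.meval (b \o idx) Q != mpoly.meval (a \o idx) Q ->
  disc_in_radial_cluster_sets M (poly_value Q (h \o idx) : Hinf N).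
Proof.
move=> ab; pose B : R := 1 + \sum_(i < m) modc (b (idx i) - a (idx i)).
have B0 : 0 < B by rewrite ltr_pwDl// sumr_ge0// => i _; exact: modc_ge0.
have ba i : modc (b (idx i) - a (idx i)) <= B.
  rewrite /B (bigD1 i)//= addrCA lerDl addr_ge0// sumr_ge0// => j _.
  exact: modc_ge0.
have eta0 : 0 < rho / B by rewrite divr_gt0.
have [r r0 Hr] := mpoly_open_along eta0 ab.
exists (mpoly.meval (a \o idx) Q), r; split=> // mu.
rewrite /disc /= modcE ltcR => /Hr[s ss smu] z Mz.
apply/rCl_approx => e e0.
(* The variables that do not occur in [Q] are left at the centre. *)
pose v i : R[i] := if i \in codom idx then a i + s * (b i - a i) else a i.
have vE i : v (idx i) = a (idx i) + s * (b (idx i) - a (idx i)).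
  by rewrite /v codom_f.
have va i : modc (v i - a i) < rho.
  rewrite /v; case: ifP => [/codomP[j ->]|_]; last by rewrite subrr modc0.
  rewrite addrC addKr modcM -[rho](divfK (lt0r_neq0 B0)).
  apply: (@le_lt_trans _ _ (md s * B)); first by rewrite ler_wpM2l ?modc_ge0.
  by rewrite ltr_pM2r.
have [d d0 Hd] := meval_continuous Q (v \o idx) e0.
pose de := Num.min (Num.min d e) 1.
have de0 : 0 < de by rewrite !lt_min d0 e0 ltr01.
have [ded dee de1] : [/\ de <= d, de <= e & de <= 1].
  by rewrite /de !ge_min !lexx !orbT.
have [t [/andP[t1 t2] Ht]] := h_dense (codom idx) va Mz de0.
have t0 : 0 <= t by move: t1; lra.
exists t; split; first by rewrite t2 andbT; move: t1; lra.
have Ntz : N (t%:C *: z) < 1.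
  by rewrite cnormZ (M_sphere Mz) mulr1 modc_real ger0_norm.
rewrite poly_value_valL0// -smu.
rewrite (_ : mpoly.meval (fun i => _ + _) Q = mpoly.meval (v \o idx) Q); last first.
  by apply: mpoly.meval_eq => i /=; rewrite vE.
apply: Hd => i /=; apply: lt_le_trans ded.
exact: Ht (codom_f idx i).
Qed.

Lemma jointly_dense_inj : injective h.
Proof.
move=> i j hij; apply/eqP; apply: contrapT => /negP ij.
have [z Mz] := M_neq0.
have close (v : I -> R[i]) : (forall k, modc (v k - a k) < rho) -> v i = v j.
  move=> va; apply/eqP; rewrite -subr_eq0; apply/eqP/modc0_eq0/eqP.
  rewrite eq_le modc_ge0 andbT; apply/ler_addgt0Pl => e e0; rewrite addr0.
  have e2 : 0 < e / 2 by rewrite divr_gt0.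
  have [t [_ Ht]] := h_dense [:: i; j] va Mz e2.
  have Hi := Ht i ltac:(by rewrite !inE eqxx).
  have Hj := Ht j ltac:(by rewrite !inE eqxx orbT).
  rewrite -(subrKA ('valL_0 (h i) (t%:C *: z))); apply: le_trans (modcD _ _) _.
  by rewrite modc_sub {2}hij [e]splitr; apply: lerD; exact: ltW.
have e1 : a i = a j by apply: close => k; rewrite subrr modc0.
have := close (fun k => a k + (if k == j then (rho / 2)%:C else 0)).
rewrite eqxx (negbTE ij) addr0 e1 => H.
have /eqP : a j = a j + (rho / 2)%:C.
  apply: H => k; rewrite addrC addKr; case: ifP => _; last by rewrite modc0.
  by rewrite modc_real ger0_norm ?divr_ge0 ?ltW// ltr_pdivrMr// ltr_pMr// ltr1n.
rewrite eq_sym addrC -subr_eq0 addrK => /eqP/complexI/eqP.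
by rewrite mulf_eq0 invr_eq0 pnatr_eq0 orbF gt_eqF.
Qed.

(** If the values of [Q] do not depend on the variables and [Q] vanishes on the
    family, then [Q] vanishes identically, hence is 0. *)
Lemma jointly_dense_independent : algebraically_independent (range h).
Proof.
move=> m g Q Gg g_inj Q0.
have gh i : exists j, h j = g i by have [j _ <-] := Gg i; exists j.
have [idx gE] := choice gh.
have {gE}gE : g = h \o idx by apply/funext => i; rewrite /= gE.
have idx_inj : injective idx.
  by move=> i j ij; apply: g_inj; rewrite gE /= ij.
have [[b ab]|nb] := pselect (exists b : I -> R[i],
    mpoly.meval (b \o idx) Q != mpoly.meval (a \o idx) Q).
  by rewrite gE; apply: disc_cluster_neq0 (jointly_dense_poly ab).
have cst (b : I -> R[i]) : mpoly.meval (b \o idx) Q = mpoly.meval (a \o idx) Q.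
  by apply/eqP; apply: contrapT => /negP ab; apply: nb; exists b.
have [u uQ] := mpoly_nonvanishing Q0.
apply/eqP => gQ0; move: uQ; apply/negP; rewrite negbK.
pose b k := if [pick i | idx i == k] is Some i then u i else 0.
have bE : mpoly.meval u Q = mpoly.meval (b \o idx) Q.
  apply: mpoly.meval_eq => i /=; rewrite /b; case: pickP => [j /eqP/idx_inj ->//|].
  by move=> /(_ i); rewrite eqxx.
pose x0 := SigSub (mem_set (unit_ball0 N)).
rewrite bE cst -(cst (fun k => h k x0)).
have := poly_value_apply Q g x0; rewrite gQ0 gE => <-.
by [].
Qed.

(** Generators may be repeated in a polynomial expression, so [idx] need not be
    injective here. *)
Lemma jointly_dense_subalgebra :
  generated_subalgebra (range h) `<=` disc_in_radial_cluster_sets M `|` [set 0].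
Proof.
move=> _ [m [g [Q [Gg Q0 ->]]]].
have gh i : exists j, h j = g i by have [j _ <-] := Gg i; exists j.
have [idx gE] := choice gh.
have {gE}-> : g = h \o idx by apply/funext => i; rewrite /= gE.
have [[b ab]|nb] := pselect (exists b : I -> R[i],
    mpoly.meval (b \o idx) Q != mpoly.meval (a \o idx) Q).
  by left; exact: jointly_dense_poly ab.
have cst (b : I -> R[i]) : mpoly.meval (b \o idx) Q = mpoly.meval (a \o idx) Q.
  by apply/eqP; apply: contrapT => /negP ab; apply: nb; exists b.
right; apply/val_inj/funext => x.
rewrite -[LHS]/((poly_value Q (h \o idx) : Hinf N) x) poly_value_apply.
rewrite -[RHS]/(0 : R[i]) -Q0 -meval0.
exact: etrans (cst (fun k => h k x)) (esym (cst (fun=> 0))).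
Qed.

End JointlyDense.

(** * A jointly dense family through a given function *)

Lemma countable_enum (T : Type) (A : set T) : countable A -> A !=set0 ->
  exists e : nat -> T, (forall i, A (e i)) /\ (forall x, A x -> exists i, e i = x).
Proof.
move=> /countable_injP[f f_inj] [x0 Ax0].
have ex i : exists x, A x /\ forall y, A y -> f y = i -> y = x.
  have [[y [Ay fy]]|no] := pselect (exists y, A y /\ f y = i).
    exists y; split=> // y' Ay' fy'; apply: f_inj; rewrite ?inE//.
    by rewrite fy' fy.
  by exists x0; split=> // y Ay fy; case: no; exists y.
have [e He] := choice ex; exists e; split=> [i|x Ax]; first by have [] := He i.
by exists (f x); have [_ H] := He (f x); apply/esym/H.
Qed.

Section StepPatterns.
Variable R : realType.
Local Notation md z := (modc z : R).

(** A pattern is a finite list of rational intervals with rational complex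
    values; it denotes the function taking at a real number the value of the
    first interval that contains it, and 0 outside all intervals. *)
Definition pattern := seq (rat * rat * (rat * rat)).

Fixpoint pattern_val (p : pattern) (al : R) : R[i] :=
  if p is (J, q) :: p' then
    if ratr J.1 < al < ratr J.2 then unit_gauss_rat R q else pattern_val p' al
  else 0.

Lemma pattern_val_le1 p al : modc (pattern_val p al) <= 1.
Proof.
elim: p => [|[J q] p IH].
  by rewrite (_ : pattern_val _ _ = 0) ?modc0.
rewrite /pattern_val -/pattern_val.
by case: ifP => // _; exact: unit_gauss_rat_le1.
Qed.

Lemma isolating_interval (s : seq R) (al : R) : al \notin s ->
  exists J : rat * rat, ratr J.1 < al < ratr J.2 /\
    forall be, be \in s -> ~~ (ratr J.1 < be < ratr J.2).
Proof.
move=> als.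
have [d d0 Hd] : exists2 d : R, 0 < d & forall be, be \in s -> d <= `|be - al|.
  elim: s als => [|be s IH]; first by exists 1.
  rewrite in_cons negb_or => /andP[albe /IH[d d0 Hd]].
  exists (Num.min d `|be - al|).
    by rewrite lt_min d0 normr_gt0 subr_eq0 eq_sym.
  move=> ga; rewrite in_cons => /orP[/eqP ->|/Hd gad].
    by rewrite ge_min lexx orbT.
  by rewrite ge_min gad.
have [p /itvP pP] := @rat_in_itvoo R (al - d) al ltac:(by rewrite gtrDl oppr_lt0).
have [q /itvP qP] := @rat_in_itvoo R al (al + d) ltac:(by rewrite ltrDl).
exists (p, q); split => /=; first by rewrite pP qP.
move=> be /Hd; apply: contraTN => /andP[pbe beq]; rewrite -ltNge ltr_distl.
by rewrite (lt_trans _ pbe) ?(lt_trans beq) ?pP ?qP.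
Qed.

Lemma pattern_dense (s : seq R) (v : R -> R[i]) (e : R) : 0 < e ->
  (forall al, modc (v al) < 1) ->
  exists p, forall al, al \in s -> modc (pattern_val p al - v al) < e.
Proof.
move=> e0 v1; elim: s => [|al s [p Hp]]; first by exists [::].
have [als|als] := boolP (al \in s).
  by exists p => be; rewrite in_cons => /orP[/eqP ->|]; exact: Hp.
have [J [Jal Js]] := isolating_interval als.
have [q Hq] := unit_gauss_rat_dense e0 (v1 al).
exists ((J, q) :: p) => be; rewrite in_cons /= => /orP[/eqP ->|bes].
  by rewrite Jal.
by rewrite (negbTE (Js _ bes)); exact: Hp.
Qed.

End StepPatterns.

Section PointwiseAlgebrability.
Variables (R : realType) (n : nat) (N : cnorm R n).
Local Notation V := 'rV[R[i]]_n.
Local Notation md z := (modc z : R).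
Local Notation half k := ((2^-1 : R) ^+ k).
Variable M : set V.
Hypothesis M_sphere : M `<=` unit_sphere N.
Hypothesis M_neq0 : M !=set0.
Hypothesis M_countable : countable M.

(** A request names a point of [M], a pattern, a target value of the given
    function, and a dummy index making each request occur infinitely often. *)
Definition request : Type := (nat * pattern * (rat * rat) * nat)%type.

(** Every function whose radial cluster sets share a disc belongs to a jointly
    dense family indexed by the real line. *)
Lemma jointly_dense_family (f : Hinf N) : disc_in_radial_cluster_sets M f ->
  exists (h : R -> Hinf N) (a : R -> R[i]) (rho : R),
    [/\ h 0 = f, 0 < rho & jointly_dense M h a rho].
Proof.
move=> [c [r [r0 Hr]]].
have [en [enM enS]] := countable_enum M_countable M_neq0.
pose dec j : request := odflt (0%N, [::], (0, 0), 0%N) (unpickle j).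
pose zi j := en (dec j).1.1.1.
pose pat j := (dec j).1.1.2.
pose tg j : R[i] := gauss_rat R (dec j).1.2.
(* Targets outside the disc of [f] impose no condition. *)
pose T j : set R := [set t | modc (tg j) < r ->
  modc ('valL_0 f (t%:C *: zi j) - (c + tg j)) < half j].
have ziS j : N (zi j) = 1 := M_sphere (enM _).
have Tacc j (s : R) : s < 1 -> exists t, T j t /\ s < t < 1.
  move=> s1; have [tr|tr] := ltP (md (tg j)) r; last first.
    exists ((s + 1) / 2); split; last by apply/andP; split; lra.
    by rewrite /T /= ltNge tr.
  have D : disc c r (c + tg j) by rewrite /disc /= addrC addKr modcE ltcR.
  have /rCl_approx H := Hr _ D (zi j) (enM _).
  have e0 : 0 < Num.min (1 - s) (half j) by rewrite lt_min subr_gt0 s1 half_exp_gt0.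
  have [t [/andP[t1 t2] Ht]] := H _ e0; exists t; split.
    by move=> _; apply: lt_le_trans Ht _; rewrite ge_min lexx orbT.
  rewrite t2 andbT; apply: le_lt_trans t1.
  by rewrite lerBrDr -lerBrDl ge_min lexx.
have [t [C [E [tP E_le E_near E_lin]]]] := asymptotic_interpolation ziS Tacc.
pose w (al : R) j := pattern_val (pat j) al.
have wb al : bounded_seq_by (w al) 1 by move=> j; exact: pattern_val_le1.
have C0 : 0 <= C.
  have := E_le (w 0) 1 (wb 0) (SigSub (mem_set (unit_ball0 N))).
  by rewrite mulr1; apply: le_trans; exact: modc_ge0.
exists (fun al => if al == 0 then f else E (w al)).
(* The centre is that of the disc of [f] in the coordinate of [f] and 0 in the
   others, whose discs have radius 1. *)
exists (fun al => if al == 0 then c else 0), (Num.min r 1).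
split; [by rewrite eqxx|by rewrite lt_min r0 ltr01|].
move=> s v va z Mz e e0.
have [i iz] := enS z Mz.
have e2 : 0 < e / 2 by rewrite divr_gt0.
have v0 : modc (v 0 - c) < r.
  by have := va 0; rewrite eqxx lt_min => /andP[].
have [q q1 q2] := gauss_rat_dense_ball e2 v0.
have [p Hp] : exists p, forall al, al \in s -> al != 0 ->
    modc (pattern_val p al - v al) < e / 2.
  pose v' al := if al == 0 then 0 else v al.
  have [al|p Hp] := @pattern_dense R s v' (e / 2) e2.
    rewrite /v'; case: eqP => [_|/eqP al0]; first by rewrite modc0.
    by have := va al; rewrite (negbTE al0) subr0 lt_min => /andP[].
  by exists p => al /Hp; rewrite /v' => + /negbTE al0; rewrite al0.
have e3 : 0 < Num.min (e / 2) e by rewrite lt_min e2.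
have [L HL] := half_exp_small (C + 1) e3.
have [k Hk] := pickle_unbounded (i, p, q) L.
set j := pickle _ in Hk.
have decj : dec j = (i, p, q, k) by rewrite /dec /j pickleK.
have zij : zi j = z by rewrite /zi decj.
have Cj : (C + 1) * half j < Num.min (e / 2) e.
  apply: le_lt_trans HL; rewrite ler_wpM2l ?addr_ge0//.
  exact: half_exp_nincr.
have hj0 := half_exp_gt0 R j.
have := mulr_ge0 C0 (ltW hj0) => Chj0.
move: Cj; rewrite lt_min mulrDl mul1r => /andP[Cj1 Cj2].
have [Tj /andP[tj1 tj2]] := tP j.
exists (t j); split; first by rewrite tj2 andbT; move: tj1; lra.
move=> al als; have [al0|al0] := eqVneq al 0.
  rewrite al0; move: Tj; rewrite /T /= /tg decj zij => /(_ q1) H.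
  rewrite -(subrKA (c + gauss_rat R q)); apply: le_lt_trans (modcD _ _) _.
  have -> : c + gauss_rat R q - v 0 = gauss_rat R q - (v 0 - c) by ring.
  by move: H q2; lra.
rewrite -(subrKA (pattern_val p al)); apply: le_lt_trans (modcD _ _) _.
have := E_near (w al) 1 (wb al) j; rewrite zij /w /pat decj /= mulr1.
by move: (Hp al als al0); lra.
Qed.

Lemma pointwise_algebra (f : Hinf N) : disc_in_radial_cluster_sets M f ->
  exists G : set (Hinf N), [/\ algebraically_independent G,
    (G #= [set: R])%card, generated_subalgebra G f &
    generated_subalgebra G `<=` disc_in_radial_cluster_sets M `|` [set 0]].
Proof.
move=> /jointly_dense_family[h [a [rho [h0 rho0 hd]]]].
exists (range h); split.
- exact: jointly_dense_independent hd.
- by apply: inj_card_eq => x y _ _; exact: jointly_dense_inj hd x y.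
- exists 1%N, (fun=> f), (mpoly.mpolyX _ (mpoly.mnm1 ord0)); split.
  + by move=> _; exists 0.
  + rewrite /constant_term mpoly.mcoeffX.
    case: eqP => // /mpoly.mnmP/(_ ord0).
    by rewrite mpoly.mnm1E mpoly.mnm0E eqxx.
  + by rewrite /poly_value mpoly.mmapX mpoly.mmap1U.
- exact: jointly_dense_subalgebra hd.
Qed.

End PointwiseAlgebrability.

(** * The space of summable sequences and operators bounded below on it *)

Section Ell1Facts.
Variable R : realType.
Local Notation md z := (modc z : R).
Local Notation half k := ((2^-1 : R) ^+ k).
Implicit Types (a b : ell1 R) (x : nat -> R[i]).

Lemma ell1_partial_le a k : \sum_(i < k) md (a i) <= ell1_norm a.
Proof.
have nd : nondecreasing_seq (series (fun k => md (a k))).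
  by apply: nondecreasing_series => j _ _; exact: modc_ge0.
have := nondecreasing_cvgn_le nd (@ell1P R a) k.
by rewrite /series /= big_mkord.
Qed.

Lemma ell1_norm_ge0 a : 0 <= ell1_norm a.
Proof. by have := ell1_partial_le a 0; rewrite big_ord0. Qed.

Lemma ell1_coord_le a i : md (a i) <= ell1_norm a.
Proof.
apply: le_trans (ell1_partial_le a i.+1); rewrite big_ord_recr /= lerDr.
by apply: sumr_ge0 => j _; exact: modc_ge0.
Qed.

Lemma ell1_norm_le a (B : R) :
  (forall k, \sum_(i < k) md (a i) <= B) -> ell1_norm a <= B.
Proof.
move=> aB; apply: limr_le; first exact: ell1P.
by apply: nearW => k; rewrite /series /= big_mkord.
Qed.

Lemma ell1_of_bounded x (B : R) :
  (forall k, \sum_(i < k) md (x i) <= B) -> exists a, forall i, a i = x i.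
Proof.
move=> xB; have xP : x \in summable_pred (R := R).
  apply/asboolP; apply: nondecreasing_is_cvgn.
    by apply: nondecreasing_series => j _ _; exact: modc_ge0.
  by exists B => _ [k _ <-]; rewrite /series /= big_mkord.
by exists (MkEll1 xP).
Qed.

Lemma ell1_normD_le a b : ell1_norm (a + b) <= ell1_norm a + ell1_norm b.
Proof. by have := ell1_normD a b; rewrite -rmorphD lecR. Qed.

Lemma ell1_norm_exceeds a (r : R) : r < ell1_norm a ->
  exists k, r < \sum_(i < k) md (a i).
Proof.
move=> ra; apply: contrapT => /forallNP H; move: ra; apply/negP.
by rewrite -leNgt; apply: ell1_norm_le => k; rewrite leNgt; apply/negP.
Qed.

(** Completeness of [ell1], for sequences with geometrically small increments. *)
Lemma ell1_complete (a : nat -> ell1 R) (c : R) :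
  (forall k, ell1_norm (a k.+1 - a k) <= c * half k) ->
  exists b, forall k, ell1_norm (a k - b) <= 2 * c * half k.
Proof.
move=> ac; have c0 : 0 <= c.
  by have := ac 0%N; rewrite expr0 mulr1; apply: le_trans; exact: ell1_norm_ge0.
have lim i : exists l, forall k, md (a k i - l) <= 4 * c * half k.
  apply: glim_cauchy => k; apply: le_trans (ac k).
  exact: ell1_coord_le (a k.+1 - a k) i.
have [x Hx] := choice lim.
have tail k p : ell1_norm (a (k + p)%N - a k) <= c * half k * (2 - 2 * half p).
  elim: p => [|p IH].
    rewrite addn0 subrr expr0 mulr1 subrr mulr0; apply: ell1_norm_le => j.
    by rewrite big1// => i _; rewrite -[X in modc X]/(0 : R[i]) modc0.
  rewrite -(subrKA (a (k + p)%N)) addnS; apply: le_trans (ell1_normD_le _ _) _.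
  apply: le_trans (lerD (ac _) IH) _; rewrite exprD exprS.
  by rewrite le_eqVlt; apply/orP; left; apply/eqP; field.
have dist k j : \sum_(i < j) md (a k i - x i) <= 2 * c * half k.
  apply: (@le_of_half_exp R (j%:R * (4 * c))) => p.
  apply: (@le_trans _ _ (\sum_(i < j) (md (a (k + p)%N i - a k i) + 4 * c * half p))).
    apply: ler_sum => i _; rewrite -(subrKA (a (k + p)%N i)).
    apply: le_trans (modcD _ _) _; rewrite modc_sub lerD2l.
    apply: le_trans (Hx i _) _; apply: ler_wpM2l; first by rewrite mulr_ge0.
    by rewrite half_exp_nincr// leq_addl.
  rewrite big_split /= sumr_const card_ord; apply: lerD.
    apply: le_trans (ell1_partial_le (a (k + p)%N - a k) j) _.
    apply: le_trans (tail k p) _.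
    have := mulr_ge0 c0 (half_exp_ge0 R k); have := half_exp_ge0 R p; nra.
  by rewrite -[leLHS]mulr_natl -!mulrA.
have [b bx] : exists b, forall i, b i = x i.
  apply: (@ell1_of_bounded x (ell1_norm (a 0%N) + 2 * c)) => j.
  apply: (@le_trans _ _ (\sum_(i < j) (md (a 0%N i) + md (a 0%N i - x i)))).
    apply: ler_sum => i _; rewrite -{1}(subKr (a 0%N i) (x i)).
    by apply: le_trans (modcD _ _) _; rewrite modcN.
  rewrite big_split /=; apply: lerD; first exact: ell1_partial_le.
  by apply: le_trans (dist 0%N j) _; rewrite expr0 mulr1.
exists b => k; apply: ell1_norm_le => j; apply: le_trans (dist k j).
apply: ler_sum => i _; rewrite -[X in modc X]/(a k i - b i).
by rewrite bx.
Qed.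

Lemma ell1_unit_vector (k : nat) : exists a, forall i, a i = (i == k)%:R.
Proof.
apply: (@ell1_of_bounded _ 1) => j.
have [kj|jk] := ltnP k j.
  rewrite (bigD1 (Ordinal kj))//= eqxx modc1 big1 ?addr0// => i.
  by rewrite -val_eqE /= => /negbTE ->; rewrite modc0.
rewrite big1 ?ler01// => i _.
by rewrite ltn_eqF ?modc0//; exact: leq_trans (ltn_ord i) jk.
Qed.

Lemma ell1_sum_apply (I : Type) (s : seq I) (F : I -> ell1 R) i :
  (\sum_(j <- s) F j) i = \sum_(j <- s) F j i.
Proof. by elim: s => [|j s IH]; rewrite ?big_nil// !big_cons -IH. Qed.

End Ell1Facts.

Section BoundedBelowOperators.
Variables (R : realType) (n : nat) (N : cnorm R n).
Local Notation half k := ((2^-1 : R) ^+ k).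
Variables (T : {linear ell1 R -> Hinf N}) (C : R).
Hypothesis T_le : forall a, hinf_norm (T a) <= C * ell1_norm a.
Hypothesis T_ge : forall a, ell1_norm a <= hinf_norm (T a).

Lemma bounded_below_inj : injective T.
Proof.
move=> a b /eqP; rewrite -subr_eq0 -linearB => /eqP Tab.
apply/eqP; rewrite -subr_eq0; apply/eqP/ell1_norm0_eq0; congr (_%:C).
apply/eqP; rewrite eq_le ell1_norm_ge0 andbT; apply: le_trans (T_ge _) _.
by rewrite Tab; apply: hinf_norm_le => x; rewrite -[X in modc X]/(0 : R[i]) modc0.
Qed.

Lemma range_linear_subspace : linear_subspace (range T).
Proof.
split; first by exists 0 => //; rewrite linear0.
by move=> c _ _ [a _ <-] [b _ <-]; exists (c *: a + b) => //; rewrite linearP.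
Qed.

Lemma hinf_normN (f : Hinf N) : hinf_norm (- f) = hinf_norm f.
Proof.
by apply: (@complexI R); rewrite -[LHS]/(`|- f|) normrN.
Qed.

Lemma hinf_normD_le (f g : Hinf N) : hinf_norm (f + g) <= hinf_norm f + hinf_norm g.
Proof. by have := hinf_normD f g; rewrite -rmorphD lecR. Qed.

(** Preimages of points of the range tending to [f] form a Cauchy sequence,
    since [T] is bounded below. *)
Lemma range_closed : closed (range T).
Proof.
move=> f clf.
have approx k : exists a, hinf_norm (T a - f) < half k.
  have [|_ [[a _ <-] /= fa]] := clf (ball f (half k)%:C).
    by apply: nbhsx_ballx; rewrite ltcR half_exp_gt0.
  exists a; move: fa; rewrite -ball_normE /= -normrN opprB.
  by rewrite -[X in X < _]/((hinf_norm (T a - f))%:C) ltcR.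
have [a Ha] := choice approx.
have C0 : 0 <= C.
  have [e eE] := ell1_unit_vector R 0.
  have e1 : 0 < ell1_norm e.
    by apply: lt_le_trans (ell1_coord_le e 0); rewrite eE eqxx modc1.
  have := le_trans (hinf_norm_ge0 _) (T_le e).
  by rewrite pmulr_lge0.
have [k|b Hb] := @ell1_complete R a 2.
  apply: le_trans (T_ge _) _; rewrite linearB -(subrKA f).
  apply: le_trans (hinf_normD_le _ _) _.
  rewrite -(opprB (T (a k)) f) hinf_normN.
  have := ltW (Ha k); have := ltW (Ha k.+1); rewrite exprS.
  have := half_exp_ge0 R k; lra.
exists b => //; apply/eqP; rewrite -subr_eq0; apply/eqP/hinf_norm0_eq0.
congr (_%:C); apply/eqP; rewrite eq_le hinf_norm_ge0 andbT.
apply: (@le_of_half_exp R (C * 4 + 1)) => k; rewrite add0r.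
rewrite -(subrKA (T (a k))); apply: le_trans (hinf_normD_le _ _) _.
rewrite -opprB hinf_normN -linearB.
have := le_trans (T_le _) (ler_wpM2l C0 (Hb k)).
have := ltW (Ha k); lra.
Qed.

Lemma range_infinite_dimensional : ~ finite_dimensional (range T).
Proof.
move=> [m [e [_ eL]]].
have [u uE] := choice (fun k => ell1_unit_vector R k).
have [c cE] := choice (fun k : 'I_m.+1 => eL (T (u k)) ltac:(by exists (u k))).
(* More unit vectors than coordinates: their images are linearly dependent. *)
pose A : 'M[R[i]]_(m.+1, m) := \matrix_(k, i) c k i.
have [v v0 vA] : exists2 v : 'rV[R[i]]_m.+1, v != 0 & v *m A = 0.
  have : kermx A != 0.
    rewrite -mxrank_eq0 mxrank_ker subn_eq0 -ltnNge.
    by apply: leq_ltn_trans (rank_leq_col A) _.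
  move=> /rowV0Pn[v vk v0]; exists v => //.
  by apply/eqP; rewrite -sub_kermx.
have Tv : T (\sum_(k < m.+1) v 0 k *: u k) = 0.
  rewrite linear_sum; under eq_bigr do rewrite linearZ_LR cE scaler_sumr.
  rewrite exchange_big big1//= => i _.
  under eq_bigr do rewrite scalerA.
  rewrite -scaler_suml; have := congr1 (fun B : 'rV_m => B 0 i) vA.
  rewrite !mxE; under eq_bigr do rewrite mxE.
  by move=> ->; rewrite scale0r.
have /bounded_below_inj sum0 : T (\sum_(k < m.+1) v 0 k *: u k) = T 0.
  by rewrite Tv linear0.
move/eqP: v0; apply; apply/rowP => k; rewrite mxE.
have := congr1 (fun a : ell1 R => a k) sum0.
rewrite ell1_sum_apply (bigD1 k)//= big1 => [|j jk].
  rewrite addr0 -[X in X = _ -> _]/(v 0 k * u k k) uE eqxx mulr1; apply.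
rewrite -[LHS]/(v 0 j * u j k) uE.
by rewrite val_eqE eq_sym (negbTE jk) mulr0.
Qed.

Lemma range_isomorphic : isomorphic_to_subspace (ell1 R) (range T).
Proof.
have Tc : continuous T.
  apply: bounded_linear_continuous; apply/linear_boundedP.
  near=> r => a; apply: (@le_trans _ _ (C%:C * `|a|)).
    rewrite -[X in X <= _]/((hinf_norm (T a))%:C).
    by rewrite -[X in _ * X]/((ell1_norm a)%:C) -rmorphM lecR.
  apply: ler_wpM2r => //; near: r; apply: nbhs_pinfty_ge.
  by apply/complex_realP; exists C.
pose S (f : Hinf N) : ell1 R := xget 0 [set a | T a = f].
have TK : cancel T S.
  by move=> a; apply: bounded_below_inj; rewrite /S; case: xgetP => [//|/(_ a)/(_ erefl)].
exists T, S; split => //.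
apply/subspace_continuousP => _ [a _ <-].
apply/cvgrPdist_lt => e e0; rewrite near_withinE.
near=> f => -[b _ bf].
have Sf : S f = b by rewrite -bf; exact: TK.
rewrite /from_subspace (TK a) Sf.
apply: (@le_lt_trans _ _ (`|T a - T b|)).
  rewrite -linearB -[X in X <= _]/((ell1_norm (a - b))%:C).
  by rewrite -[X in _ <= X]/((hinf_norm (T (a - b)))%:C) lecR.
by rewrite bf; near: f; exact: cvgr_dist_lt.
Unshelve. all: by end_near. Qed.

End BoundedBelowOperators.

(** * A copy of the space of summable sequences *)

Section Ell1Copy.
Variables (R : realType) (n : nat) (N : cnorm R n).
Local Notation V := 'rV[R[i]]_n.
Local Notation md z := (modc z : R).
Local Notation half k := ((2^-1 : R) ^+ k).
Variable M : set V.
Hypothesis M_sphere : M `<=` unit_sphere N.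
Hypothesis M_neq0 : M !=set0.
Hypothesis M_countable : countable M.

(** The pairing of a summable sequence with a finite sequence of rational
    points of the closed unit disc. *)
Definition rat_pairing (p : seq (rat * rat)) (a : ell1 R) : R[i] :=
  \sum_(i < size p) a i * unit_gauss_rat R (nth (0, 0) p i).

Lemma rat_pairing_le p a : modc (rat_pairing p a) <= ell1_norm a.
Proof.
apply: le_trans (modc_sum _ _ _) _; apply: le_trans (ell1_partial_le a (size p)).
apply: ler_sum => i _; rewrite modcM ler_piMr ?modc_ge0//.
exact: unit_gauss_rat_le1.
Qed.

Lemma rat_pairing_linear p (c : R[i]) a b :
  rat_pairing p (c *: a + b) = c * rat_pairing p a + rat_pairing p b.
Proof.
rewrite /rat_pairing mulr_sumr -big_split /=; apply: eq_bigr => i _.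
rewrite -[LHS]/((c * a i + b i) * unit_gauss_rat R (nth (0, 0) p i)).
by rewrite mulrDl mulrA.
Qed.

(** The pairings with [a] are dense in the disc whose radius is the norm of
    [a]. *)
Lemma rat_pairing_dense a (mu : R[i]) (e : R) : modc mu < ell1_norm a -> 0 < e ->
  exists p, modc (rat_pairing p a - mu) < e.
Proof.
move=> mua e0; have [k Hk] := ell1_norm_exceeds mua.
set S := \sum_(i < k) md (a i) in Hk.
have S0 : 0 < S := le_lt_trans (modc_ge0 mu) Hk.
(* The phases of the [d i] turn all [a i * d i] in the direction of [mu]. *)
pose d i : R[i] := if a i == 0 then 0 else (md (a i))%:C / a i * (mu / S%:C).
have d1 i : modc (d i) < 1.
  rewrite /d; case: eqP => [_|/eqP ai]; first by rewrite modc0.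
  rewrite !modcM !ComplexField.Normc.normcV !modc_real !ger0_norm ?modc_ge0 ?(ltW S0)//.
  rewrite mulfV ?mul1r ?ltr_pdivrMr ?mul1r//.
  by apply: contra ai => /eqP/modc0_eq0 ->.
have e' : 0 < e / (S + 1) by rewrite divr_gt0// addr_gt0.
have [q Hq] := choice (fun i => unit_gauss_rat_dense e' (d1 i)).
exists (mkseq q k); rewrite /rat_pairing size_mkseq.
have -> : mu = \sum_(i < k) a i * d i.
  have aid i : a i * d i = (md (a i))%:C * (mu / S%:C).
    rewrite /d; case: eqP => [->|/eqP ai]; first by rewrite modc0 !mul0r.
    by rewrite mulrA [a i * _]mulrC divfK.
  under eq_bigr do rewrite aid.
  rewrite -mulr_suml -(rmorph_sum (real_complex R)) mulrC divfK//.
  by apply: contraTneq S0 => /complexI ->; rewrite ltxx.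
rewrite -sumrB; apply: le_lt_trans (modc_sum _ _ _) _.
apply: (@le_lt_trans _ _ (\sum_(i < k) md (a i) * (e / (S + 1)))).
  apply: ler_sum => i _; rewrite -mulrBr modcM nth_mkseq//.
  by apply: ler_wpM2l; rewrite ?modc_ge0// ltW.
rewrite -mulr_suml -/S mulrA ltr_pdivrMr ?addr_gt0// mulrC ltr_pM2l//.
by rewrite ltrDl.
Qed.

(** The radial cluster sets of [T a] contain the open disc of radius |a|, which
    also shows that [T] is bounded below. *)
Lemma ell1_operator : exists (T : {linear ell1 R -> Hinf N}) (C : R),
  [/\ forall a, hinf_norm (T a) <= C * ell1_norm a,
    forall a, ell1_norm a <= hinf_norm (T a) &
    forall a, a != 0 -> disc_in_radial_cluster_sets M (T a)].
Proof.
have [en [enM enS]] := countable_enum M_countable M_neq0.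
pose dec j : nat * seq (rat * rat) * nat := odflt (0%N, [::], 0%N) (unpickle j).
pose zi j := en (dec j).1.1.
have ziS j : N (zi j) = 1 := M_sphere (enM _).
have Tacc (j : nat) (s : R) : s < 1 -> exists t, [set: R] t /\ s < t < 1.
  move=> s1; exists ((s + 1) / 2); split=> //; apply/andP; split; lra.
have [t [C [E [tP E_le E_near E_lin]]]] 
  := @asymptotic_interpolation R n N zi (fun=> [set: R]) ziS Tacc.
pose w a j := rat_pairing (dec j).1.2 a.
have wb a : bounded_seq_by (w a) (ell1_norm a) by move=> j; exact: rat_pairing_le.
have Tlin : linear (fun a => E (w a)).
  move=> c a b; rewrite -(E_lin c _ _ _ _ (wb a) (wb b)); congr E.
  by apply/funext => j; exact: rat_pairing_linear.
pose T : {linear ell1 R -> Hinf N} :=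
  HB.pack (fun a => E (w a)) (GRing.isLinear.Build _ _ _ _ _ Tlin).
have TE a : T a = E (w a) by [].
have T_le a : hinf_norm (T a) <= C * ell1_norm a.
  by apply: hinf_norm_le => x; rewrite TE; exact: E_le.
have cluster a (mu : R[i]) z : modc mu < ell1_norm a -> M z -> rCl (T a) z mu.
  move=> mua Mz; apply/rCl_approx => e e0.
  have [i iz] := enS z Mz.
  have e2 : 0 < e / 2 by rewrite divr_gt0.
  have [p Hp] := rat_pairing_dense mua e2.
  have e3 : 0 < Num.min (e / 2) e by rewrite lt_min e2.
  have A0 := ell1_norm_ge0 a.
  have CA0 : 0 <= C * ell1_norm a := le_trans (hinf_norm_ge0 _) (T_le a).
  have [L HL] := half_exp_small (C * ell1_norm a + 1) e3.
  have [k Hk] := pickle_unbounded (i, p) L.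
  set j := pickle _ in Hk.
  have decj : dec j = (i, p, k) by rewrite /dec /j pickleK.
  have zij : zi j = z by rewrite /zi decj.
  have Cj : (C * ell1_norm a + 1) * half j < Num.min (e / 2) e.
    apply: le_lt_trans HL; rewrite ler_wpM2l ?addr_ge0//.
    exact: half_exp_nincr.
  have hj0 := half_exp_gt0 R j.
  have := mulr_ge0 CA0 (ltW hj0) => Chj0.
  move: Cj; rewrite lt_min mulrDl mul1r => /andP[Cj1 Cj2].
  have [_ /andP[tj1 tj2]] := tP j.
  exists (t j); split; first by rewrite tj2 andbT; move: tj1; lra.
  rewrite TE -(subrKA (w a j)); apply: le_lt_trans (modcD _ _) _.
  have := E_near (w a) _ (wb a) j; rewrite zij.
  have -> : w a j = rat_pairing p a by rewrite /w decj.
  by move: Hp; lra.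
have [z0 Mz0] := M_neq0.
exists T, C; split=> // [a|a a0].
  apply/ler_addgt0Pl => e e0; have [ea|ae] := ltP e (ell1_norm a); last first.
    by apply: le_trans ae _; rewrite lerDl hinf_norm_ge0.
  rewrite -lerBlDl; have ea0 : 0 <= ell1_norm a - e by rewrite subr_ge0 ltW.
  have := rCl_le (M_sphere Mz0) (cluster a (ell1_norm a - e)%:C z0 _ Mz0).
  rewrite modc_real ger0_norm//; apply.
  by rewrite gtrBl.
exists 0, (ell1_norm a); split.
  rewrite lt_neqAle ell1_norm_ge0 andbT eq_sym; apply: contra a0 => /eqP a0.
  by apply/eqP/ell1_norm0_eq0; rewrite a0.
move=> mu; rewrite /disc /= subr0 modcE ltcR => mua z Mz.
exact: cluster.
Qed.

Lemma ell1_copy :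
  contains_copy_of (ell1 R) (disc_in_radial_cluster_sets M `|` [set (0 : Hinf N)]) /\
  spaceable (disc_in_radial_cluster_sets M : set (Hinf N)).
Proof.
have [T [C [T_le T_ge TF]]] := ell1_operator.
have sub : range T `<=` disc_in_radial_cluster_sets M `|` [set (0 : Hinf N)].
  move=> _ [a _ <-]; have [->|a0] := eqVneq a 0; first by right; rewrite /= linear0.
  by left; exact: TF.
split; exists (range T); split => //.
- exact: range_linear_subspace.
- exact: range_closed T_le T_ge.
- exact: range_isomorphic T_le T_ge.
- exact: range_linear_subspace.
- exact: range_closed T_le T_ge.
- exact: range_infinite_dimensional T_ge.
Qed.

Lemma disc_functions_neq0 : (disc_in_radial_cluster_sets M : set (Hinf N)) !=set0.
Proof.
have [T [_ [_ _ TF]]] := ell1_operator.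
have [e eE] := ell1_unit_vector R 0; exists (T e); apply: TF.
apply/eqP => e0; have := eE 0%N; rewrite e0 eqxx.
by move=> /eqP; rewrite -[X in X == _]/(0 : R[i]) eq_sym oner_eq0.
Qed.

End Ell1Copy.

Theorem theorem1p4 (R : realType) (n : nat) (n_ge1 : (1 <= n)%N)
    (N : cnorm R n) (M : set 'rV[R[i]]_n)
    (M_sphere : M `<=` unit_sphere N) (M_neq0 : M !=set0)
    (M_countable : countable M) :
  let F := disc_in_radial_cluster_sets (N := N) M in
  (contains_copy_of (ell1 R) (F `|` [set 0]) /\ spaceable F) /\
  (pointwise_strongly_algebrable [set: R] F /\
   strongly_algebrable [set: R] F).
Proof.
move=> F; split; first exact: ell1_copy.
have algebra f : F f -> exists G : set (Hinf N), [/\ algebraically_independent G,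
    (G #= [set: R])%card, generated_subalgebra G f &
    generated_subalgebra G `<=` F `|` [set 0]].
  exact: pointwise_algebra.
have F_neq0 : F !=set0 by exact: disc_functions_neq0.
split; first by split.
have [f /algebra[G [G1 G2 _ G4]]] := F_neq0.
by exists G.
Qed.
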